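(* There are absolute constants $B_0<\infty$ and $K<\infty$ such that, for every $M\ge1$ and every analytic polynomial (in any finite number of complex variables) \[ F=\sum_{r=0}^{M}F_r, \] where $F_r$ is $r$-homogeneous, \[ \left[\sum_{r=1}^{M}\frac{\|a(F_r)\|_{q_r}^{2}}{r^{2B_0}}\right]^{1/2}\le K\|F\|_\infty . \] Consequently, \[ D_m\le K m^{B_0}\qquad(m\ge1). \] One may take $B_0=5$.
   Context: For a polynomial $Q(z)=\sum_\nu c_\nu z^\nu$ on $\mathbb C^n$ write $\|Q\|_\infty=\sup_{z\in\mathbb D^n}|Q(z)|$ and $\|a(Q)\|_p=(\sum_\nu|c_\nu|^p)^{1/p}$. For $r\ge1$ put $q_r=\frac{2r}{r+1}$. $D_m$ is the optimal complex polynomial Bohnenblust--Hille constant: $D_m=\sup_{n\ge1}D_{m,n}$, where $D_{m,n}$ is the supremum of $\|a(P)\|_{q_m}/\|P\|_\infty$ over nonzero $m$-homogeneous polynomials $P$ on $\mathbb C^n$ (it is known that $D_m<\infty$). *)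

(* Defs.v *)
From HB Require Import structures.
From mathcomp Require Import all_boot all_order all_algebra.
From mathcomp Require Import all_classical all_reals all_analysis.
From mathcomp Require Import complex.
(* The notations of mpoly are incompatible with those of mathcomp-analysis. *)
From mathcomp Require Import -(notations) mpoly.

Set Implicit Arguments.
Unset Strict Implicit.
Unset Printing Implicit Defensive.

Import Order.TTheory GRing.Theory Num.Theory.

Local Open Scope classical_set_scope.
Local Open Scope ring_scope.

(* The R-valued modulus; `|z| would be an element of R[i]. *)
Notation cmod := ComplexField.Normc.normc.

(* The notation d.-homog of mpoly. *)
Notation homog d := (ishomog1 d mdeg).

Definition polydisc (R : realType) (n : nat) : set ('I_n -> R[i]) :=
  [set z | forall i, cmod (z i) < 1].

(* The set is nonempty and bounded, so the real-valued sup is the actual one. *)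
Definition supnorm (R : realType) (n : nat) (Q : mpoly n R[i]) : R :=
  sup [set cmod (meval z Q) | z in @polydisc R n].

Definition coefnorm (R : realType) (n : nat) (p : R) (Q : mpoly n R[i]) : R :=
  (\sum_(nu <- msupp Q) cmod (mcoeff nu Q) `^ p) `^ p^-1.

Definition bh_exp (R : realType) (r : nat) : R := (2 * r)%:R / r.+1%:R.

Definition bh_const_dim (R : realType) (m n : nat) : \bar R :=
  ereal_sup [set (coefnorm (bh_exp R m) P / supnorm P)%:E
            | P in [set P : mpoly n R[i] | P \is homog m /\ P != 0]].

Definition bh_const (R : realType) (m : nat) : \bar R :=
  ereal_sup [set bh_const_dim R m n | n in [set n | (1 <= n)%N]].

(* Main.v *)
(* Let z = x on a set A of variables and z = y off A. This substitution does not increase the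
   sup norm, and it splits each monomial of degree r into a factor of degree k in x and a
   factor of degree l = r - k in y. For fixed y the inequality in degrees below r applies in x;
   averaging over y in the torus and using hypercontractivity bounds the coefficients in
   l^{q_k}(l^2), and exchanging A with its complement bounds them in the symmetric norm. Blei's
   inequality then gives an l^{q_r} bound, which is averaged over random sets A.

   Two points make the constants close up. The inequality is proved for the l^2 sum over all
   degrees at once, so that summing over the possible k costs nothing; and the weight r^{-10}
   gains (k^{k/r} l^{l/r} / r)^{10} when the split is balanced (r/4 <= k <= 3r/4), which
   happens for at least half of the sets A unless one exponent exceeds r/2.

   A monomial with an exponent k > r/2 at the variable i is treated with a sparse random A
   containing only i among the variables of the monomial. There the l^{q_k}(l^2) norm is
   controlled by sum_i |c_{k e_i}| <= 1, so K enters only to the power l/r < 1/2; the loss of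
   powers of r is absorbed by the weight, and that of the constant by taking K large. *)
Require Import Defs.
From mathcomp Require Import all_boot all_order all_algebra.
From mathcomp Require Import all_classical all_reals all_analysis.
From mathcomp Require Import complex.
From mathcomp Require Import -(notations) mpoly.
From mathcomp Require Import cyclic separable cyclotomic.
From mathcomp Require Import ring lra zify.

Set Implicit Arguments.
Unset Strict Implicit.
Unset Printing Implicit Defensive.

Import Order.TTheory GRing.Theory Num.Theory.

Local Open Scope ring_scope.

(** * Hoelder and Minkowski inequalities for finite sums *)

(** The torus is replaced by tuples of [Q]-th roots of unity. For [Q] above the exponents involved
    the monomials stay orthonormal there, so every average is a finite sum and every Fourier
    identity is exact.

    Summing over degrees must be free in l as well as in k. One average over y therefore has to
    control all l at once, which calls for hypercontractivity of inhomogeneous polynomials. The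
    fourth-moment argument gives it one degree at a time; the tensor power trick removes the number
    of degrees, and the price is a damping factor 4^(-l/k) on the part of degree l in y.

    The recursion closes when 1 + 96 (5/8)^10 K^2 + 336 K <= K^2. With these constants 10 is the
    least integer e for which 96 (5/8)^e < 1, hence the weight r^10 and B_0 = 5. The unbalanced
    monomials contribute the term linear in K only, so a large K absorbs it. *)

Lemma powR_young (R : realType) (x y t : R) :
  0 <= x -> 0 <= y -> 0 < t <= 1 -> x `^ t * y `^ (1 - t) <= t * x + (1 - t) * y.
Proof.
move=> x0 y0 /andP[t0]; rewrite le_eqVlt => /predU1P[->|t1].
  by rewrite subrr powRr0 powRr1// mulr1 mul1r mul0r addr0.
have t1' : 0 < 1 - t by rewrite subr_gt0.
have := @conjugate_powR R (x `^ t) (y `^ (1 - t)) t^-1 (1 - t)^-1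
  (powR_ge0 _ _) (powR_ge0 _ _).
rewrite !invr_gt0 !invrK -!powRrM !mulfV ?gt_eqF// ?powRr1//.
move=> /(_ t0 t1'); rewrite addrC subrK => /(_ erefl).
by rewrite [x * t]mulrC [y * _]mulrC.
Qed.

Lemma powR_sumr_eq0 (R : realType) (I : finType) (P : pred I) (x : I -> R) t :
  0 < t -> (forall i, 0 <= x i) -> \sum_(i | P i) x i = 0 ->
  forall i, P i -> x i `^ t = 0.
Proof.
move=> t0 x0 /eqP; rewrite psumr_eq0// => /allP xE i Pi.
by move: (xE i (mem_index_enum i)); rewrite Pi => /eqP ->; rewrite powR0// gt_eqF.
Qed.

Lemma powRV (R : realType) (x t : R) : 0 <= x -> x^-1 `^ t = (x `^ t)^-1.
Proof. by move=> x0; rewrite -powR_inv1// powRAC powR_inv1// powR_ge0. Qed.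

Lemma hoelder_sum (R : realType) (I : finType) (P : pred I) (x y : I -> R) (t : R) :
  0 < t <= 1 -> (forall i, 0 <= x i) -> (forall i, 0 <= y i) ->
  \sum_(i | P i) x i `^ t * y i `^ (1 - t) <=
  (\sum_(i | P i) x i) `^ t * (\sum_(i | P i) y i) `^ (1 - t).
Proof.
move=> /andP[t0 t1] x0 y0; have [te|tn] := eqVneq t 1.
  rewrite te subrr powRr0 mulr1 powRr1 ?sumr_ge0//.
  by under eq_bigr do rewrite powRr0 mulr1 powRr1//.
have t1' : 0 < 1 - t by rewrite subr_gt0 lt_neqAle tn.
set X := \sum_(i | P i) x i; set Y := \sum_(i | P i) y i.
have X0 : 0 <= X by exact: sumr_ge0.
have Y0 : 0 <= Y by exact: sumr_ge0.
have [Xe|Xn] := eqVneq X 0.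
  rewrite big1 ?mulr_ge0 ?powR_ge0// => i Pi.
  by rewrite (powR_sumr_eq0 t0 x0 Xe)// mul0r.
have [Ye|Yn] := eqVneq Y 0.
  rewrite big1 ?mulr_ge0 ?powR_ge0// => i Pi.
  by rewrite (powR_sumr_eq0 t1' y0 Ye)// mulr0.
have Xp : 0 < X by rewrite lt_def Xn.
have Yp : 0 < Y by rewrite lt_def Yn.
rewrite -[leRHS]mulr1 -ler_pdivrMl ?mulr_gt0 ?powR_gt0// mulr_sumr.
apply: (@le_trans _ _ (\sum_(i | P i) (t * (x i / X) + (1 - t) * (y i / Y)))).
  apply: ler_sum => i _.
  apply: le_trans (powR_young (divr_ge0 (x0 i) X0) (divr_ge0 (y0 i) Y0) _); last first.
    by rewrite t0.
  rewrite !powRM ?invr_ge0// !powRV// invfM le_eqVlt; apply/orP; left; apply/eqP; ring.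
rewrite big_split/= -!mulr_sumr -!mulr_suml -/X -/Y !mulfV ?gt_eqF//; lra.
Qed.

Lemma powR_sum_le (R : realType) (I : finType) (P : pred I) (x : I -> R) (s : R) :
  1 <= s -> (forall i, 0 <= x i) ->
  (\sum_(i | P i) x i) `^ s <= #|P|%:R `^ (s - 1) * \sum_(i | P i) x i `^ s.
Proof.
move=> s1 x0; have s0 : 0 < s by apply: lt_le_trans s1.
have := @hoelder_sum R I P (fun i => x i `^ s) (fun=> 1) s^-1.
rewrite invr_gt0 s0 invf_le1// s1 => /(_ erefl (fun=> powR_ge0 _ _) (fun=> ler01)).
under eq_bigr do rewrite powR1 mulr1 -powRrM mulfV ?gt_eqF// powRr1//.
rewrite sumr_const => H.
rewrite mulrC.
have -> : \sum_(i | P i) x i `^ s =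
   ((\sum_(i | P i) x i `^ s) `^ s^-1) `^ s.
  by rewrite -powRrM mulVf ?gt_eqF// powRr1// sumr_ge0// => i _; exact: powR_ge0.
have -> : #|P|%:R `^ (s - 1) = (#|P|%:R `^ (1 - s^-1)) `^ s :> R.
  by rewrite -powRrM mulrBl mul1r mulVf ?gt_eqF.
rewrite -powRM ?powR_ge0//; apply: ge0_ler_powR; rewrite ?nnegrE ?mulr_ge0 ?powR_ge0 ?sumr_ge0//.
  exact: ltW.
Qed.

(** One factor of [G i ^ s] is expanded as a sum over [j]. Hoelder in [i] bounds each [j] by its
    norm times [Z ^ (1 - s^-1)], and this power of [Z] is divided out at the end. *)
Lemma minkowski_sum (R : realType) (I J : finType) (P : pred I) (Q : pred J)
    (t : I -> J -> R) (s : R) :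
  1 <= s -> (forall i j, 0 <= t i j) ->
  \sum_(i | P i) (\sum_(j | Q j) t i j) `^ s <=
  (\sum_(j | Q j) (\sum_(i | P i) t i j `^ s) `^ s^-1) `^ s.
Proof.
move=> s1 t0; have s0 : 0 < s by apply: lt_le_trans s1.
set G := fun i => \sum_(j | Q j) t i j.
have G0 i : 0 <= G i by exact: sumr_ge0.
set Z := \sum_(i | P i) G i `^ s.
have Z0 : 0 <= Z by apply: sumr_ge0 => i _; exact: powR_ge0.
set M := \sum_(j | Q j) _.
have M0 : 0 <= M by apply: sumr_ge0 => i _; exact: powR_ge0.
have [->|Zn] := eqVneq Z 0; first exact: powR_ge0.
have Zp : 0 < Z by rewrite lt_def Zn.
have ZE : Z `^ s^-1 * Z `^ (1 - s^-1) = Z.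
  by rewrite -powRD ?Zn ?implybT// addrC subrK powRr1.
suff H : Z <= M * Z `^ (1 - s^-1).
  have Zle : Z `^ s^-1 <= M.
    by move: H; rewrite -{1}ZE ler_pM2r// powR_gt0.
  have -> : Z = (Z `^ s^-1) `^ s by rewrite -powRrM mulVf ?gt_eqF// powRr1.
  by apply: ge0_ler_powR; rewrite ?nnegrE ?powR_ge0 ?(ltW s0).
rewrite mulr_suml {1}/Z.
have -> : \sum_(i | P i) G i `^ s =
    \sum_(j | Q j) \sum_(i | P i) t i j * G i `^ (s - 1).
  rewrite exchange_big/=; apply: eq_bigr => i _.
  by rewrite -mulr_suml -/(G i) mulr_powRB1.
apply: ler_sum => j _.
apply: le_trans (@hoelder_sum R I P (fun i => t i j `^ s) (fun i => G i `^ s) s^-1 _ _ _).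
- apply: ler_sum => i _.
  rewrite -!powRrM mulfV ?gt_eqF// powRr1// mulrBr mulr1 mulfV ?gt_eqF//.
- by rewrite invr_gt0 s0 invf_le1.
- by move=> i; exact: powR_ge0.
- by move=> i; exact: powR_ge0.
Qed.

(** * Roots of unity *)

Lemma cmod_ge0 (R : realType) (z : R[i]) : 0 <= cmod z.
Proof. by case: z => a b; exact: sqrtr_ge0. Qed.

Lemma norm_cmod (R : realType) (z : R[i]) : `|z| = (cmod z)%:C%C.
Proof. by case: z. Qed.

Lemma cmodX (R : realType) (z : R[i]) k : cmod (z ^+ k) = cmod z ^+ k.
Proof.
by elim: k => [|k IHk]; [exact: Normc.normc1 | rewrite !exprS Normc.normcM IHk].
Qed.

Lemma cmod_prod (R : realType) (I : finType) (z : I -> R[i]) :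
  cmod (\prod_i z i) = \prod_i cmod (z i).
Proof.
by elim/big_rec2: _ => [|i x y _ <-]; [exact: Normc.normc1 | rewrite Normc.normcM].
Qed.

Lemma cmod_sum (R : realType) (I : finType) (P : pred I) (z : I -> R[i]) :
  cmod (\sum_(i | P i) z i) <= \sum_(i | P i) cmod (z i).
Proof.
elim/big_rec2: _ => [|i x y _ xy]; first by rewrite Normc.normc0.
by apply: le_trans (le_normcD _ _) _; rewrite lerD2l.
Qed.

Lemma sqr_cmodE (R : realType) (z : R[i]) : ((cmod z ^+ 2)%:C = z * z^*)%C.
Proof. by rewrite -sqr_normc norm_cmod rmorphXn. Qed.

Lemma prim_root_exists (R : realType) n : (0 < n)%N ->
  exists z : R[i], n.-primitive_root z.
Proof.
pose p : {poly R[i]} := 'X^n - 1; have [r Dp] := closed_field_poly_normal p.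
move=> n_gt0; rewrite (monicP _) ?monicXnsubC // scale1r in Dp.
have rn1 : all n.-unity_root r by apply/allP=> z; rewrite -root_prod_XsubC -Dp.
have sz_r : (n < (size r).+1)%N.
  by rewrite -(size_prod_XsubC r id) -Dp size_XnsubC.
have [|z] := hasP (has_prim_root n_gt0 rn1 _ sz_r); last by exists z.
by rewrite -separable_prod_XsubC -Dp separable_Xn_sub_1 // pnatr_eq0 -lt0n.
Qed.

Lemma root_exists (R : realType) n (u : R[i]) : (0 < n)%N -> exists v, v ^+ n = u.
Proof.
move=> n0; have /closed_rootP[v] : size ('X^n - u%:P) != 1%N.
  by rewrite size_XnsubC// eqSS -lt0n.
by rewrite rootE hornerD hornerN hornerXn hornerC subr_eq0 => /eqP; exists v.
Qed.

Lemma cmod_root1 (R : realType) n (v : R[i]) :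
  (0 < n)%N -> cmod v ^+ n = 1 -> cmod v = 1.
Proof. by move=> n0 /eqP; rewrite pexpr_eq1 ?cmod_ge0// => /eqP. Qed.

Lemma cmod_prim_root (R : realType) n (z : R[i]) :
  n.-primitive_root z -> cmod z = 1.
Proof.
move=> zP; apply: (cmod_root1 (prim_order_gt0 zP)).
by rewrite -cmodX (prim_expr_order zP) Normc.normc1.
Qed.

Lemma conjc_unimod (R : realType) (z : R[i]) : cmod z = 1 -> (z^* = z^-1)%C.
Proof.
move=> z1; have := sqr_cmodE z; rewrite z1 expr1n => zz.
have z0 : z != 0 by apply/eqP => z0; move: z1; rewrite z0 Normc.normc0 => /eqP; rewrite eq_sym oner_eq0.
by apply: (mulfI z0); rewrite -zz mulfV.
Qed.

Lemma sum_root_expr (R : realType) Q (z : R[i]) (a b : nat) :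
  Q.-primitive_root z ->
  \sum_(j < Q) (z ^+ a) ^+ j * (((z ^+ b) ^+ j)^*)%C =
  (if a == b %[mod Q] then Q%:R else 0).
Proof.
move=> zP; have z1 := cmod_prim_root zP.
have z0 : z != 0.
  by apply/eqP => z0; move: z1; rewrite z0 Normc.normc0 => /eqP; rewrite eq_sym oner_eq0.
pose x := z ^+ a / z ^+ b.
transitivity (\sum_(j < Q) x ^+ j).
  apply: eq_bigr => j _.
  by rewrite conjc_unimod ?cmodX ?z1 ?expr1n// /x expr_div_n.
case: ifPn => [|ab].
  rewrite -(eq_prim_root_expr zP) => /eqP zab.
  have -> : x = 1 by rewrite /x zab mulfV// expf_neq0.
  by under eq_bigr do rewrite expr1n; rewrite sumr_const card_ord.
have x1 : x - 1 != 0.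
  rewrite subr_eq0; apply: contra ab => /eqP xE; rewrite -(eq_prim_root_expr zP).
  apply/eqP; have : x * z ^+ b = z ^+ b by rewrite xE mul1r.
  by rewrite /x divfK// expf_neq0.
apply: (mulfI x1); rewrite mulr0.
have := subrXX x 1 Q; rewrite expr1n.
under eq_bigr do rewrite expr1n mulr1.
have -> : x ^+ Q = 1.
  by rewrite /x expr_div_n -!exprM mulnC [(b * Q)%N]mulnC !exprM (prim_expr_order zP) !expr1n divr1.
rewrite subrr => H; apply/esym; rewrite [LHS]H; congr (_ * _).
rewrite (reindex_inj rev_ord_inj)/=; apply: eq_bigr => i _.
by congr (_ ^+ _); have := ltn_ord i; lia.
Qed.

(** * Polynomials on the discrete torus *)

(* A polynomial with all exponents at most [d] is a coefficient function on [expo I d]. *)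
Definition expo (I : finType) (d : nat) : finType := {ffun I -> 'I_d.+1}.

Definition wt (I : finType) d (g : expo I d) : nat := \sum_i g i.

Definition mono (R : realType) (I : finType) d (z : I -> R[i]) (g : expo I d) : R[i] :=
  \prod_i z i ^+ g i.

Definition peval (R : realType) (I : finType) d (c : expo I d -> R[i]) (z : I -> R[i]) : R[i] :=
  \sum_g c g * mono z g.

Definition upt (R : realType) (zeta : R[i]) (I : finType) Q (w : {ffun I -> 'I_Q}) : I -> R[i] :=
  fun i => zeta ^+ w i.

Definition avg (R : realType) (T : finType) (f : T -> R) : R :=
  #|T|%:R^-1 * \sum_t f t.

Lemma ler_avg (R : realType) (T : finType) (f g : T -> R) :
  (forall t, f t <= g t) -> avg f <= avg g.
Proof. by move=> fg; rewrite ler_wpM2l ?invr_ge0// ler_sum. Qed.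

Lemma avg_ge0 (R : realType) (T : finType) (f : T -> R) :
  (forall t, 0 <= f t) -> 0 <= avg f.
Proof. by move=> f0; rewrite mulr_ge0 ?invr_ge0// sumr_ge0. Qed.

Lemma avg_le (R : realType) (T : finType) (f : T -> R) (b : R) :
  0 <= b -> (forall t, f t <= b) -> avg f <= b.
Proof.
move=> b0 fb; have [T0|T0] := posnP #|T|.
  by rewrite /avg T0 invr0 mul0r.
rewrite /avg ler_pdivrMl ?ltr0n//; apply: le_trans (ler_sum _ (fun i _ => fb i)) _.
by rewrite sumr_const mulr_natl.
Qed.

Lemma avg_sum (R : realType) (T J : finType) (P : pred J) (f : J -> T -> R) :
  avg (fun t => \sum_(j | P j) f j t) = \sum_(j | P j) avg (f j).
Proof. by rewrite /avg exchange_big/= mulr_sumr. Qed.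

Lemma avgZ (R : realType) (T : finType) (f : T -> R) (b : R) :
  avg (fun t => b * f t) = b * avg f.
Proof. by rewrite /avg -mulr_sumr mulrCA. Qed.

Lemma jensen_avg (R : realType) (T : finType) (f : T -> R) (s : R) :
  1 <= s -> (forall t, 0 <= f t) -> avg f `^ s <= avg (fun t => f t `^ s).
Proof.
move=> s1 f0; have s0 : 0 < s by apply: lt_le_trans s1.
have [T0|T0] := posnP #|T|.
  by rewrite /avg T0 invr0 !mul0r powR0// gt_eqF.
have Tp : 0 < #|T|%:R :> R by rewrite ltr0n.
rewrite /avg powRM ?invr_ge0 ?sumr_ge0// powRV//.
rewrite ler_pdivrMl ?powR_gt0//; apply: le_trans (powR_sum_le _ s1 f0) _.
rewrite mulrA ler_wpM2r// ?sumr_ge0// => [i _|]; first exact: powR_ge0.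
rewrite powRB ?(gt_eqF Tp) ?implybT// powRr1//.
Qed.

Lemma mono_orth (R : realType) (I : finType) d Q (zeta : R[i]) (g h : expo I d) :
  Q.-primitive_root zeta -> (d < Q)%N ->
  \sum_(w : {ffun I -> 'I_Q}) mono (upt zeta w) g * ((mono (upt zeta w) h)^*)%C =
  if g == h then (Q ^ #|I|)%:R else 0.
Proof.
move=> zP dQ.
transitivity (\prod_i \sum_(j < Q) (zeta ^+ g i) ^+ j * (((zeta ^+ h i) ^+ j)^*)%C).
  rewrite bigA_distr_bigA; apply: eq_bigr => w _.
  rewrite /mono rmorph_prod -big_split/=; apply: eq_bigr => i _.
  by rewrite /upt -!exprM mulnC [(w i * h i)%N]mulnC.
have small (f : expo I d) i : (f i < Q)%N by apply: leq_trans (ltn_ord _) _.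
case: ifPn => [/eqP ->|gh].
  under eq_bigr do rewrite sum_root_expr// eqxx.
  by rewrite prodr_const natrX.
have [i gi] : exists i, g i != h i.
  by apply/existsP; apply: contraR gh => /existsPn/= E; apply/eqP/ffunP => i; apply/eqP; rewrite -[_ == _]negbK.
rewrite (bigD1 i)//= sum_root_expr// !modn_small// ifN ?mul0r//.
Qed.

(** Exponents at most [d < Q] are distinct modulo [Q], so distinct monomials are distinct characters
    of the group of tuples of [Q]-th roots of unity. *)
Lemma parseval (R : realType) (I : finType) d Q (zeta : R[i]) (a : expo I d -> R[i]) :
  Q.-primitive_root zeta -> (d < Q)%N ->
  avg (fun w : {ffun I -> 'I_Q} => cmod (peval a (upt zeta w)) ^+ 2) =
  \sum_g cmod (a g) ^+ 2.
Proof.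
move=> zP dQ; rewrite /avg card_ffun card_ord.
have Q0 : (Q ^ #|I|)%:R != 0 :> R by rewrite pnatr_eq0 expn_eq0 negb_and -lt0n (leq_trans _ dQ).
apply: (mulfI Q0); rewrite mulrA mulfV// mul1r.
apply: (@fmorph_inj _ _ (@real_complex R)).
rewrite rmorphM !rmorph_sum/= rmorph_nat.
under eq_bigr => w _.
  rewrite sqr_cmodE {2}/peval rmorph_sum/= mulr_sumr.
  under eq_bigr do rewrite /peval mulr_suml.
  over.
rewrite exchange_big/= mulr_sumr; apply: eq_bigr => h _.
rewrite exchange_big/=.
transitivity (\sum_g a g * ((a h)^*)%C * (if g == h then (Q ^ #|I|)%:R else 0)).
  apply: eq_bigr => g _; rewrite -(mono_orth _ _ zP dQ) mulr_sumr.
  by apply: eq_bigr => w _; rewrite rmorphM mulrACA.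
rewrite (bigD1 h)//= eqxx big1 ?addr0 => [|g /negPf ->]; last by rewrite mulr0.
by rewrite sqr_cmodE mulrC.
Qed.

(** * Fourth moments of homogeneous polynomials *)

Definition addx (I : finType) d (g h : expo I d) : expo I (d + d) :=
  [ffun i => inord (g i + h i)].

Lemma addxE (I : finType) d (g h : expo I d) i : addx g h i = (g i + h i)%N :> nat.
Proof. by rewrite ffunE inordK// ltnS leq_add// -ltnS. Qed.

Lemma mono_addx (R : realType) (I : finType) d (z : I -> R[i]) (g h : expo I d) :
  mono z (addx g h) = mono z g * mono z h.
Proof.
by rewrite /mono -big_split/=; apply: eq_bigr => i _; rewrite addxE exprD.
Qed.

Lemma wt_addx (I : finType) d (g h : expo I d) : wt (addx g h) = (wt g + wt h)%N.
Proof. by rewrite /wt -big_split/=; apply: eq_bigr => i _; rewrite addxE. Qed.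

(** A pair is determined by its first member, which lies below [e] coordinatewise. This leaves at
    most prod (e_i + 1) <= prod 2^(e_i) = 2^(2l) choices. *)
Lemma card_addx_le (I : finType) d l (e : expo I (d + d)) :
  (#|[pred p : expo I d * expo I d |
      [&& addx p.1 p.2 == e, wt p.1 == l & wt p.2 == l]]| <= 4 ^ l)%N.
Proof.
set P := [pred p : _ * _ | _].
have [we|we] := eqVneq (wt e) (l + l)%N; last first.
  rewrite [X in (X <= _)%N](_ : _ = 0%N)//; apply: eq_card0 => -[g h]; rewrite !inE/=.
  apply/negP => /and3P[/eqP eE /eqP gl /eqP hl].
  by move: we; rewrite -eE wt_addx gl hl eqxx.
have inj : {in P &, injective (fun p : expo I d * expo I d => p.1)}.
  move=> [g h] [g' h']; rewrite !inE/= => /and3P[/eqP e1 _ _] /and3P[/eqP e2 _ _] gg.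
  rewrite gg; congr (_, _); apply/ffunP => i; apply/val_inj/eqP.
  by rewrite -(eqn_add2l (g i)) -addxE e1 -e2 addxE gg.
rewrite -(card_in_image inj).
apply: (@leq_trans #|family (fun i : I => [pred x : 'I_d.+1 | (x <= e i)%N])|).
  apply: subset_leq_card; apply/fintype.subsetP => g /fintype.imageP[[g1 h]]; rewrite inE/=.
  move=> /and3P[/eqP eE _ _] ->; apply/familyP => i; rewrite inE.
  by rewrite -eE addxE leq_addr.
rewrite card_family foldrE big_map big_enum/=.
apply: (@leq_trans (\prod_(i : I) 2 ^ e i)).
  apply: leq_prod => i _; apply: leq_trans (ltn_expl (e i) (ltnSn 1)).
  have -> : (e i).+1 = #|'I_(e i).+1| by rewrite card_ord.
  pose f (x : 'I_d.+1) : 'I_(e i).+1 := inord x.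
  have finj : {in [pred x : 'I_d.+1 | (x <= e i)%N] &, injective f}.
    move=> x y; rewrite !inE => xe ye /(congr1 val).
    by rewrite /f/= !inordK// => /val_inj.
  by rewrite -(card_in_image finj) max_card.
by rewrite -expn_sum -/(wt e) we addnn -mul2n expnM.
Qed.

Lemma sqr_sum_le (R : realType) (T : finType) (P : pred T) (x : T -> R) (N : nat) :
  (#|P| <= N)%N -> (forall t, 0 <= x t) ->
  (\sum_(t | P t) x t) ^+ 2 <= N%:R * \sum_(t | P t) x t ^+ 2.
Proof.
move=> PN x0; have := @powR_sum_le R T P x 2 (ler1n _ _) x0.
rewrite powR_mulrn ?sumr_ge0// => H; apply: le_trans H _.
rewrite [2 - 1](_ : _ = 1); last by lra.
rewrite powRr1// ler_pM ?ler_nat ?sumr_ge0// => [i _|]; first exact: powR_ge0.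
by apply: ler_sum => i _; rewrite powR_mulrn.
Qed.

(** Parseval is applied to the square of the polynomial, whose exponents reach [d + d]. Each of its
    coefficients is a sum over at most 4^l pairs, to which Cauchy-Schwarz applies. *)
Lemma avg_pow4_le (R : realType) (I : finType) d Q l (zeta : R[i]) (a : expo I d -> R[i]) :
  Q.-primitive_root zeta -> (d + d < Q)%N -> (forall g, wt g != l -> a g = 0) ->
  avg (fun w : {ffun I -> 'I_Q} => cmod (peval a (upt zeta w)) ^+ 4) <=
  4 ^+ l * avg (fun w : {ffun I -> 'I_Q} => cmod (peval a (upt zeta w)) ^+ 2) ^+ 2.
Proof.
move=> zP dQ al.
pose P e := [pred p : expo I d * expo I d |
      [&& addx p.1 p.2 == e, wt p.1 == l & wt p.2 == l]].
pose s (e : expo I (d + d)) := \sum_(p | P e p) a p.1 * a p.2.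
have sE (z : I -> R[i]) : peval a z ^+ 2 = peval s z.
  rewrite expr2 /peval mulr_suml.
  under eq_bigr do rewrite mulr_sumr.
  rewrite pair_big/= (partition_big (fun p => addx p.1 p.2) predT)//=.
  apply: eq_bigr => e _; rewrite /s mulr_suml big_mkcond [RHS]big_mkcond/=.
  apply: eq_bigr => -[g h] _ /=; case: eqP => //= ge.
  case: eqP => /= [wg|/eqP/al ->]; last by rewrite !mul0r.
  case: eqP => /= [wh|/eqP/al ->]; last by rewrite mul0r mulr0.
  by rewrite -ge mono_addx; ring.
have -> : avg (fun w : {ffun I -> 'I_Q} => cmod (peval a (upt zeta w)) ^+ 4) =
    avg (fun w : {ffun I -> 'I_Q} => cmod (peval s (upt zeta w)) ^+ 2).
  congr avg; apply/funext => w.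
  by rewrite -sE cmodX -exprM.
rewrite !(parseval _ zP)//; last by apply: leq_ltn_trans dQ; exact: leq_addr.
set A := \sum_g cmod (a g) ^+ 2.
have AE : A ^+ 2 = \sum_(p : expo I d * expo I d) (cmod (a p.1) * cmod (a p.2)) ^+ 2.
  rewrite expr2 mulr_suml; under eq_bigr do rewrite mulr_sumr.
  by rewrite pair_big/=; apply: eq_bigr => p _; rewrite exprMn.
rewrite AE (partition_big (fun p => addx p.1 p.2) predT)//= mulr_sumr.
apply: ler_sum => e _.
apply: (@le_trans _ _ ((\sum_(p | P e p) cmod (a p.1) * cmod (a p.2)) ^+ 2)).
  rewrite ler_sqr ?nnegrE ?cmod_ge0 ?sumr_ge0// => [|p _]; last by rewrite mulr_ge0 ?cmod_ge0.
  apply: le_trans (cmod_sum _ _) _; apply: ler_sum => p _.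
  by rewrite Normc.normcM.
apply: le_trans (sqr_sum_le (card_addx_le l e) _) _ => [p|].
  by rewrite mulr_ge0 ?cmod_ge0.
rewrite natrX ler_wpM2l ?exprn_ge0//.
rewrite big_mkcond [leRHS]big_mkcond; apply: ler_sum => p _ /=.
by rewrite /P/=; case: eqP => //= _; case: ifP => // _; rewrite sqr_ge0.
Qed.

(** * Hypercontractivity *)

Lemma hoelder_avg (R : realType) (T : finType) (x y : T -> R) (t : R) :
  0 < t <= 1 -> (forall i, 0 <= x i) -> (forall i, 0 <= y i) ->
  avg (fun i => x i `^ t * y i `^ (1 - t)) <= avg x `^ t * avg y `^ (1 - t).
Proof.
move=> t01 x0 y0; have [T0|T0] := posnP #|T|.
  by rewrite /avg T0 invr0 !mul0r mulr_ge0 ?powR_ge0.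
have Tp : 0 < #|T|%:R :> R by rewrite ltr0n.
have TE : #|T|%:R^-1 `^ t * #|T|%:R^-1 `^ (1 - t) = #|T|%:R^-1 :> R.
  rewrite -powRD ?invr_eq0 ?(gt_eqF Tp) ?implybT//.
  by rewrite addrC subrK powRr1 ?invr_ge0.
rewrite /avg !powRM ?invr_ge0 ?sumr_ge0// mulrACA TE ler_wpM2l ?invr_ge0//.
exact: hoelder_sum.
Qed.

Lemma bh_exp_gt0 (R : realType) k : (0 < k)%N -> 0 < bh_exp R k.
Proof. by move=> k0; rewrite divr_gt0// ltr0n ?muln_gt0. Qed.

Lemma bh_exp_ge1 (R : realType) k : (0 < k)%N -> 1 <= bh_exp R k.
Proof. by move=> k0; rewrite ler_pdivlMr ?ltr0n// mul1r ler_nat; lia. Qed.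

(* [1 + 1/k] is [2 / q_k]. *)
Lemma bh_expM (R : realType) k : (0 < k)%N -> bh_exp R k * (1 + k%:R^-1) = 2.
Proof.
move=> k0; rewrite /bh_exp natrM -(natr1 k).
have k0' : 0 < k%:R :> R by rewrite ltr0n.
field; lra.
Qed.

(* Hoelder between [L^q] and [L^4], with the bound [4 ^ l] for the fourth moment. *)
Lemma homog_hypercontractive (R : realType) (I : finType) d Q l k (zeta : R[i])
    (a : expo I d -> R[i]) :
  Q.-primitive_root zeta -> (d + d < Q)%N -> (0 < k)%N ->
  (forall g, wt g != l -> a g = 0) ->
  \sum_g cmod (a g) ^+ 2 <= 4 `^ (l%:R / k%:R) *
  (avg (fun w : {ffun I -> 'I_Q} => cmod (peval a (upt zeta w)) `^ bh_exp R k))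
     `^ (1 + k%:R^-1).
Proof.
move=> zP dQ k0 al; rewrite -(parseval _ zP); last by apply: leq_ltn_trans dQ; exact: leq_addr.
have := avg_pow4_le zP dQ al.
set f := fun w : {ffun I -> 'I_Q} => cmod (peval a (upt zeta w)).
rewrite -/(f _) -/(f _).
have f0 w : 0 <= f w by exact: cmod_ge0.
set N2 := avg (fun w => f w ^+ 2); set N4 := avg (fun w => f w ^+ 4) => H4.
set Nq := avg (fun w => f w `^ bh_exp R k).
have N20 : 0 <= N2 by apply: avg_ge0 => w; exact: sqr_ge0.
have N40 : 0 <= N4 by apply: avg_ge0 => w; exact: exprn_ge0.
have Nq0 : 0 <= Nq by apply: avg_ge0 => w; exact: powR_ge0.
have [->|N2n] := eqVneq N2 0; first by rewrite mulr_ge0 ?powR_ge0.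
have N2p : 0 < N2 by rewrite lt_def N2n.
have kp : 0 < k%:R :> R by rewrite ltr0n.
(* The interpolation parameter solves 2 = q_k t + 4 (1 - t). *)
pose t : R := (k%:R + 1) / (k%:R + 2).
have t01 : 0 < t <= 1.
  by rewrite divr_gt0/= ?ler_pdivrMr; lra.
have tE : 1 - t = (k%:R + 2)^-1 by rewrite /t; field; lra.
have H2 : N2 <= Nq `^ t * N4 `^ (1 - t).
  have := @hoelder_avg R _ (fun w => f w `^ bh_exp R k) (fun w => f w ^+ 4) t t01.
  move=> /(_ (fun=> powR_ge0 _ _) (fun=> exprn_ge0 _ (f0 _))).
  rewrite -/Nq -/N4; congr (_ <= _); congr avg; apply/funext => w.
  rewrite -(powR_mulrn 4)// -!powRrM -powRD.
    rewrite -powR_mulrn// tE; congr (_ `^ _).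
    by rewrite /bh_exp /t natrM -(natr1 k); field; lra.
  apply/implyP; rewrite tE /bh_exp /t natrM -(natr1 k) => /eqP.
  suff : 0 < 2 * k%:R / (k%:R + 1) * ((k%:R + 1) / (k%:R + 2)) + 4 * (k%:R + 2)^-1 :> R.
    by move=> /[swap] ->; rewrite ltxx.
  by rewrite addr_gt0 ?mulr_gt0 ?invr_gt0//; lra.
have kk2 : 0 < k%:R / (k%:R + 2) :> R by rewrite divr_gt0//; lra.
(* The fourth moment brings back N2^2 to the power 1 - t; dividing by it leaves a smaller power of
   [N2] on the left. *)
have H : N2 `^ (k%:R / (k%:R + 2)) <= Nq `^ t * 4 `^ (l%:R * (k%:R + 2)^-1).
  have N2s : 0 < N2 `^ (2 * (k%:R + 2)^-1) by rewrite powR_gt0.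
  rewrite -(ler_pM2r N2s) -powRD ?N2n ?implybT//.
  have -> : k%:R / (k%:R + 2) + 2 * (k%:R + 2)^-1 = 1 :> R by field; lra.
  rewrite powRr1//; apply: le_trans H2 _.
  rewrite -mulrA ler_wpM2l ?powR_ge0// tE.
  rewrite [4 `^ _]powRrM [N2 `^ _]powRrM !powR_mulrn// -powRM ?exprn_ge0//.
  have W0 : 0 <= 4 ^+ l * N2 ^+ 2 by rewrite (mulr_ge0 _ (sqr_ge0 _)) ?exprn_ge0.
  by apply: ge0_ler_powR; rewrite ?nnegrE ?invr_ge0//; lra.
have -> : N2 = (N2 `^ (k%:R / (k%:R + 2))) `^ ((k%:R + 2) / k%:R).
  by rewrite -powRrM mulrA divfK ?mulfV ?powRr1// gt_eqF//; lra.
have -> : 4 `^ (l%:R / k%:R) * Nq `^ (1 + k%:R^-1) =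
    (Nq `^ t * 4 `^ (l%:R * (k%:R + 2)^-1)) `^ ((k%:R + 2) / k%:R).
  rewrite powRM ?powR_ge0// -!powRrM mulrC; congr (_ `^ _ * _ `^ _).
    by rewrite /t; field; lra.
  by field; lra.
by apply: ge0_ler_powR; rewrite ?nnegrE ?mulr_ge0 ?powR_ge0 ?divr_ge0//; lra.
Qed.

(** * Homogeneous components as averages over rotations *)

Definition homc (R : realType) (I : finType) d l (a : expo I d -> R[i]) : expo I d -> R[i] :=
  fun g => if wt g == l then a g else 0.

Lemma wt_le (I : finType) d (g : expo I d) : (wt g <= #|I| * d)%N.
Proof.
rewrite -[#|I|]sum1_card big_distrl/= leq_sum// => i _.
by rewrite mul1n -ltnS.
Qed.

Lemma mono_scale (R : realType) (I : finType) d (u : R[i]) (z : I -> R[i]) (g : expo I d) :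
  mono (fun i => u * z i) g = u ^+ wt g * mono z g.
Proof.
rewrite /mono /wt; under eq_bigr do rewrite exprMn.
by rewrite big_split/= expr_sum.
Qed.

(** This extracts the l-th Fourier coefficient in the common rotation. All weights are at most
    [#|I| * d < Q], so congruence modulo [Q] selects exactly the degree [l]. *)
Lemma peval_homc (R : realType) (I : finType) d Q l (zeta : R[i]) (a : expo I d -> R[i])
    (z : I -> R[i]) :
  Q.-primitive_root zeta -> (#|I| * d < Q)%N -> (l < Q)%N ->
  \sum_(t < Q) (((zeta ^+ l) ^+ t)^*)%C * peval a (fun i => zeta ^+ t * z i) =
  Q%:R * peval (homc l a) z.
Proof.
move=> zP IQ lQ; rewrite /peval mulr_sumr.
under eq_bigr do rewrite mulr_sumr.
rewrite exchange_big/=; apply: eq_bigr => g _.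
transitivity (a g * mono z g *
    \sum_(t < Q) (zeta ^+ wt g) ^+ t * (((zeta ^+ l) ^+ t)^*)%C).
  rewrite mulr_sumr; apply: eq_bigr => t _.
  by rewrite mono_scale [(zeta ^+ t) ^+ _]exprAC; ring.
rewrite (sum_root_expr _ _ zP) !modn_small//; last first.
  by apply: leq_ltn_trans IQ; exact: wt_le.
by rewrite /homc; case: ifP => _; rewrite ?mulr0 ?mul0r ?mulr0//; ring.
Qed.

Lemma cmod_peval_homc (R : realType) (I : finType) d Q l (zeta : R[i])
    (a : expo I d -> R[i]) (z : I -> R[i]) :
  Q.-primitive_root zeta -> (#|I| * d < Q)%N -> (l < Q)%N ->
  cmod (peval (homc l a) z) <=
  avg (fun t : 'I_Q => cmod (peval a (fun i => zeta ^+ t * z i))).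
Proof.
move=> zP IQ lQ; have Q0 : (0 < Q)%N by apply: leq_ltn_trans lQ.
have Qp : 0 < Q%:R :> R by rewrite ltr0n.
rewrite /avg card_ord ler_pdivlMl//.
have <- : cmod (Q%:R : R[i]) = Q%:R.
  rewrite -[RHS]mulr1 mulr_natl -(Normc.normc1 R) -(normcMn (1 : R[i]) Q).
  by [].
rewrite -Normc.normcM -(peval_homc _ _ zP)//.
apply: le_trans (cmod_sum _ _) _; apply: ler_sum => t _.
rewrite Normc.normcM conjc_unimod ?Normc.normcV ?cmodX ?(cmod_prim_root zP) ?expr1n//.
by rewrite invr1 mul1r.
Qed.

Lemma avg_rotate (R : realType) (I : finType) d Q (zeta : R[i]) (a : expo I d -> R[i]) (t : nat)
    (h : R -> R) :
  Q.-primitive_root zeta ->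
  avg (fun w : {ffun I -> 'I_Q} => h (cmod (peval a (fun i => zeta ^+ t * upt zeta w i)))) =
  avg (fun w : {ffun I -> 'I_Q} => h (cmod (peval a (upt zeta w)))).
Proof.
move=> zP; case: Q zP (prim_order_gt0 zP) => // Q zP _; rewrite /avg; congr (_ * _).
pose u : {ffun I -> 'I_Q.+1} := [ffun=> inord (t %% Q.+1)].
rewrite [RHS](reindex_inj (addrI u)); apply: eq_bigr => w _.
congr (h (cmod (peval a _))); apply/funext => i.
rewrite /upt !ffunE/= (prim_expr_mod zP) exprD inordK ?ltn_pmod// (prim_expr_mod zP)//.
Qed.

(** Taking a homogeneous component averages over rotations, which preserve the L^q average, so it is
    a contraction by Jensen. *)
Lemma avg_homc_le (R : realType) (I : finType) d Q l (zeta : R[i]) (a : expo I d -> R[i])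
    (q : R) :
  Q.-primitive_root zeta -> (#|I| * d < Q)%N -> (l < Q)%N -> 1 <= q ->
  avg (fun w : {ffun I -> 'I_Q} => cmod (peval (homc l a) (upt zeta w)) `^ q) <=
  avg (fun w : {ffun I -> 'I_Q} => cmod (peval a (upt zeta w)) `^ q).
Proof.
move=> zP IQ lQ q1; have q0 : 0 <= q by apply: le_trans q1.
apply: (@le_trans _ _ (avg (fun w : {ffun I -> 'I_Q} =>
   avg (fun t : 'I_Q => cmod (peval a (fun i => zeta ^+ t * upt zeta w i)) `^ q)))).
  apply: ler_avg => w; apply: le_trans (jensen_avg q1 (fun t => cmod_ge0 _)).
  apply: ge0_ler_powR; rewrite ?nnegrE ?cmod_ge0//.
    by apply: avg_ge0 => t; exact: cmod_ge0.
  exact: cmod_peval_homc.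
rewrite [leLHS](_ : _ = avg (fun t : 'I_Q => avg (fun w : {ffun I -> 'I_Q} =>
    cmod (peval a (fun i => zeta ^+ t * upt zeta w i)) `^ q))); last first.
  by rewrite /avg -!mulr_sumr exchange_big/= mulrCA.
apply: avg_le => [|t]; first by apply: avg_ge0 => w; exact: powR_ge0.
by rewrite (@avg_rotate R I d Q zeta a t (fun x => x `^ q)).
Qed.

(** The squared L^2 norm of the dilated polynomial z -> a(2^(-1/k) z). The radius is the one for
    which the factor 4^(l/k) of the homogeneous estimate cancels in every degree l. *)
Definition damped (R : realType) (I : finType) d k (a : expo I d -> R[i]) : R :=
  \sum_g 4 `^ (- ((wt g)%:R / k%:R)) * cmod (a g) ^+ 2.

Lemma damped_ge0 (R : realType) (I : finType) d k (a : expo I d -> R[i]) :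
  0 <= damped k a.
Proof. by apply: sumr_ge0 => g _; rewrite mulr_ge0 ?powR_ge0 ?sqr_ge0. Qed.

Lemma damped_le_lossy (R : realType) (I : finType) d Q k (zeta : R[i]) (a : expo I d -> R[i]) :
  Q.-primitive_root zeta -> (d + d < Q)%N -> (#|I| * d < Q)%N -> (0 < k)%N ->
  damped k a <= (#|I| * d).+1%:R *
  (avg (fun w : {ffun I -> 'I_Q} => cmod (peval a (upt zeta w)) `^ bh_exp R k))
     `^ (1 + k%:R^-1).
Proof.
move=> zP dQ IQ k0; set N := avg _.
have -> : damped k a = \sum_(l < (#|I| * d).+1)
    4 `^ (- (l%:R / k%:R)) * \sum_g cmod (homc l a g) ^+ 2.
  rewrite /damped; under [RHS]eq_bigr do rewrite mulr_sumr.
  rewrite exchange_big/=; apply: eq_bigr => g _.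
  pose l0 : 'I_(#|I| * d).+1 := Ordinal (wt_le g : (wt g < (#|I| * d).+1)%N).
  rewrite (bigD1 l0)//= big1 ?addr0 /homc ?eqxx// => l ll0.
  case: eqP => [e|]; last by rewrite Normc.normc0 expr0n/= mulr0.
  by case/eqP: ll0; apply/val_inj; rewrite /= e.
apply: (@le_trans _ _ (\sum_(l < (#|I| * d).+1) N `^ (1 + k%:R^-1))); last first.
  by rewrite sumr_const card_ord mulr_natl.
apply: ler_sum => l _; rewrite powRN mulrC ler_pdivrMr ?powR_gt0// mulrC.
apply: le_trans (@homog_hypercontractive R I d Q l k zeta _ zP dQ k0 _) _.
  by move=> g gl; rewrite /homc ifN.
apply: ler_wpM2l; first exact: powR_ge0.
have lQ : (l < Q)%N by apply: leq_ltn_trans IQ; rewrite -ltnS.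
have H := avg_homc_le a zP IQ lQ (bh_exp_ge1 R k0).
apply: ge0_ler_powR H; first by rewrite addr_ge0 ?invr_ge0.
- by rewrite nnegrE; apply: avg_ge0 => w; exact: powR_ge0.
- by rewrite nnegrE; apply: avg_ge0 => w; exact: powR_ge0.
Qed.

Definition inlf (I J : finType) (X : Type) (g : {ffun I + J -> X}) : {ffun I -> X} :=
  [ffun i => g (inl i)].

Definition inrf (I J : finType) (X : Type) (g : {ffun I + J -> X}) : {ffun J -> X} :=
  [ffun i => g (inr i)].

Lemma big_sum_ffun (V : nmodType) (I J X : finType)
    (F : {ffun I -> X} -> {ffun J -> X} -> V) :
  \sum_(g : {ffun I + J -> X}) F (inlf g) (inrf g) = \sum_g \sum_h F g h.
Proof.
rewrite pair_big/=.
pose u (p : {ffun I -> X} * {ffun J -> X}) : {ffun I + J -> X} :=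
  [ffun s => match s with inl i => p.1 i | inr j => p.2 j end].
have ul p : inlf (u p) = p.1 by apply/ffunP => i; rewrite !ffunE.
have ur p : inrf (u p) = p.2 by apply/ffunP => i; rewrite !ffunE.
rewrite (reindex u)/=; last first.
  exists (fun g => (inlf g, inrf g)) => [p _|g _]; first by rewrite ul ur -surjective_pairing.
  by apply/ffunP => -[i|j]; rewrite !ffunE.
by apply: eq_bigr => p _; rewrite ul ur.
Qed.

Definition tensor (R : realType) (I : finType) d (a : expo I d -> R[i]) :
  expo (I + I)%type d -> R[i] := fun g => a (inlf g) * a (inrf g).

Lemma damped_tensor (R : realType) (I : finType) d k (a : expo I d -> R[i]) :
  damped k (tensor a) = damped k a ^+ 2.
Proof.
pose F g h := (4 `^ (- ((wt g)%:R / k%:R)) * cmod (a g) ^+ 2) *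
  (4 `^ (- ((wt h)%:R / k%:R)) * cmod (a h) ^+ 2).
transitivity (\sum_(g : expo (I + I)%type d) F (inlf g) (inrf g)).
  apply: eq_bigr => g _; rewrite /F /tensor Normc.normcM exprMn.
  rewrite [RHS]mulrACA -powRD ?pnatr_eq0 ?implybT//; congr (4 `^ _ * _).
  rewrite -opprD -mulrDl -natrD; congr (- (_%:R / _)).
  rewrite /wt big_sumType/=; congr (_ + _)%N; apply: eq_bigr => i _; by rewrite ffunE.
rewrite big_sum_ffun expr2 mulr_suml; apply: eq_bigr => g _.
by rewrite mulr_sumr.
Qed.

Lemma peval_tensor (R : realType) (I : finType) d (a : expo I d -> R[i]) (z : I + I -> R[i]) :
  peval (tensor a) z = peval a (fun i => z (inl i)) * peval a (fun i => z (inr i)).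
Proof.
pose F g h := (a g * mono (fun i => z (inl i)) g) * (a h * mono (fun i => z (inr i)) h).
transitivity (\sum_(g : expo (I + I)%type d) F (inlf g) (inrf g)).
  apply: eq_bigr => g _; rewrite /F /tensor mulrACA; congr (_ * _).
  rewrite /mono big_sumType/=; congr (_ * _); apply: eq_bigr => i _; by rewrite ffunE.
rewrite big_sum_ffun /peval mulr_suml; apply: eq_bigr => g _.
by rewrite mulr_sumr.
Qed.

Lemma avg_tensor (R : realType) (I : finType) d Q (zeta : R[i]) (q : R) (a : expo I d -> R[i]) :
  avg (fun w : {ffun I + I -> 'I_Q} => cmod (peval (tensor a) (upt zeta w)) `^ q) =
  avg (fun w : {ffun I -> 'I_Q} => cmod (peval a (upt zeta w)) `^ q) ^+ 2.
Proof.
pose f (w : {ffun I -> 'I_Q}) := cmod (peval a (upt zeta w)) `^ q.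
rewrite /avg !card_ffun card_sum expnD natrM invfM exprMn expr2; congr (_ * _).
transitivity (\sum_(w : {ffun I + I -> 'I_Q}) f (inlf w) * f (inrf w)).
  apply: eq_bigr => w _; rewrite peval_tensor Normc.normcM powRM ?cmod_ge0//.
  congr (cmod (peval a _) `^ q * cmod (peval a _) `^ q); apply/funext => i;
    by rewrite /upt ffunE.
rewrite (big_sum_ffun (fun g h => f g * f h)) expr2 mulr_suml; apply: eq_bigr => g _.
by rewrite mulr_sumr.
Qed.

(* The factor counting the degrees in [damped_le_lossy] is removed by the tensor power trick:
   [tensor a] squares both sides but only doubles the degree. *)
Lemma damped_le_power (R : realType) Q (zeta : R[i]) k j :
  Q.-primitive_root zeta -> (0 < k)%N -> forall (I : finType) d (a : expo I d -> R[i]),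
  (d + d < Q)%N -> (2 ^ j * (#|I| * d) < Q)%N ->
  damped k a ^+ (2 ^ j) <= (2 ^ j * (#|I| * d)).+1%:R *
  ((avg (fun w : {ffun I -> 'I_Q} => cmod (peval a (upt zeta w)) `^ bh_exp R k))
     `^ (1 + k%:R^-1)) ^+ (2 ^ j).
Proof.
move=> zP k0; elim: j => [|j IHj] I d a dQ IQ.
  by rewrite expn0 mul1n !expr1; apply: damped_le_lossy => //; rewrite mul1n in IQ.
have := IHj _ d (tensor a) dQ; rewrite card_sum damped_tensor avg_tensor.
have E : (2 ^ j * ((#|I| + #|I|) * d))%N = (2 ^ j.+1 * (#|I| * d))%N by rewrite expnS; lia.
rewrite E => /(_ IQ).
set N := avg _; have N0 : 0 <= N by apply: avg_ge0 => w; exact: powR_ge0.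
have -> : (N ^+ 2) `^ (1 + k%:R^-1) = (N `^ (1 + k%:R^-1)) ^+ 2 by rewrite expr2 powRM// expr2.
by rewrite -!exprM -expnS.
Qed.

(** With D = [#|I| * d], the tensor power of order 2^(D+1) leaves the factor 2^(D+1) D + 1 <=
    2^(2^(D+1)), whose root of order 2^(D+1) is at most 2. [Q0] must exceed the degree of that
    tensor power, and depends on neither [k] nor [a]. *)
Lemma hypercontractive (R : realType) (I : finType) d :
  exists Q0, forall Q (zeta : R[i]) k (a : expo I d -> R[i]),
  (Q0 < Q)%N -> Q.-primitive_root zeta -> (0 < k)%N ->
  damped k a <= 2 *
  (avg (fun w : {ffun I -> 'I_Q} => cmod (peval a (upt zeta w)) `^ bh_exp R k))
     `^ (1 + k%:R^-1).
Proof.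
set D := (#|I| * d)%N.
exists (maxn (d + d) (2 ^ D.+1 * D)) => Q zeta k a; rewrite gtn_max => /andP[dQ DQ] zP k0.
have := damped_le_power zP k0 a dQ DQ; rewrite -/D.
set N := avg _; have N0 : 0 <= N by apply: avg_ge0 => w; exact: powR_ge0.
have le2 : ((2 ^ D.+1 * D).+1 <= 2 ^ (2 ^ D.+1))%N.
  have D2 : (D < 2 ^ D)%N by exact: ltn_expl.
  have p2 : (0 < 2 ^ D.+1)%N by rewrite expn_gt0.
  apply: (@leq_trans (2 ^ D.+1 * 2 ^ D)%N); first by nia.
  rewrite -expnD leq_pexp2l// expnS; lia.
move=> H; rewrite -(@ler_pXn2r _ (2 ^ D.+1)) ?nnegrE ?damped_ge0 ?mulr_ge0 ?powR_ge0//; last first.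
  by rewrite expn_gt0.
apply: le_trans H _; rewrite exprMn ler_wpM2r ?exprn_ge0 ?powR_ge0//.
by rewrite -natrX ler_nat.
Qed.

(** * Splitting the variables *)

Definition onset (I : finType) d (A : {set I}) (g : expo I d) : bool :=
  [forall i, (i \notin A) ==> (g i == ord0)].

Definition mergex (I : finType) d (A : {set I}) (b g : expo I d) : expo I d :=
  [ffun i => if i \in A then b i else g i].

Definition restx (I : finType) d (A : {set I}) (g : expo I d) : expo I d :=
  [ffun i => if i \in A then g i else ord0].

Definition mergez (R : realType) (I : finType) (A : {set I}) (x y : I -> R[i]) : I -> R[i] :=
  fun i => if i \in A then x i else y i.

Lemma onset_restx (I : finType) d (A : {set I}) (g : expo I d) : onset A (restx A g).
Proof. by apply/forallP => i; apply/implyP => /negPf iA; rewrite ffunE iA. Qed.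

Lemma mergex_restx (I : finType) d (A : {set I}) (g : expo I d) :
  mergex A (restx A g) (restx (~: A) g) = g.
Proof. by apply/ffunP => i; rewrite !ffunE finset.in_setC; case: (i \in A). Qed.

Lemma restx_mergexl (I : finType) d (A : {set I}) (b g : expo I d) :
  onset A b -> restx A (mergex A b g) = b.
Proof.
move=> /forallP bA; apply/ffunP => i; rewrite !ffunE.
case: (boolP (i \in A)) => //= iA.
by move: (bA i); rewrite iA => /eqP.
Qed.

Lemma restx_mergexr (I : finType) d (A : {set I}) (b g : expo I d) :
  onset (~: A) g -> restx (~: A) (mergex A b g) = g.
Proof.
move=> /forallP gA; apply/ffunP => i; rewrite !ffunE finset.in_setC.
case: (boolP (i \in A)) => //= iA.
by move: (gA i); rewrite finset.in_setC iA => /eqP.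
Qed.

Lemma mergexC (I : finType) d (A : {set I}) (b g : expo I d) :
  mergex (~: A) b g = mergex A g b.
Proof. by apply/ffunP => i; rewrite !ffunE finset.in_setC; case: (i \in A). Qed.

Lemma sum_mergex (V : nmodType) (I : finType) d (A : {set I}) (F : expo I d -> V) :
  \sum_a F a = \sum_(b | onset A b) \sum_(g | onset (~: A) g) F (mergex A b g).
Proof.
rewrite pair_big/= (reindex_onto (fun a => (restx A a, restx (~: A) a))
  (fun p => mergex A p.1 p.2))/=; last first.
  by move=> [b g] /andP[bA gA]/=; rewrite restx_mergexl// restx_mergexr.
apply: eq_big => [a|a _]; last by rewrite mergex_restx.
by rewrite !onset_restx mergex_restx eqxx.
Qed.

Lemma wt_mergex (I : finType) d (A : {set I}) (b g : expo I d) :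
  onset A b -> onset (~: A) g -> wt (mergex A b g) = (wt b + wt g)%N.
Proof.
move=> /forallP bA /forallP gA; rewrite /wt -big_split/=; apply: eq_bigr => i _.
move: (bA i) (gA i); rewrite ffunE finset.in_setC; case: (i \in A) => /=.
  by move=> _ /eqP ->; rewrite addn0.
by move=> /eqP -> _.
Qed.

Lemma mono_mergex (R : realType) (I : finType) d (A : {set I}) (x y : I -> R[i])
    (b g : expo I d) : onset A b -> onset (~: A) g ->
  mono (mergez A x y) (mergex A b g) = mono x b * mono y g.
Proof.
move=> /forallP bA /forallP gA; rewrite /mono -big_split/=; apply: eq_bigr => i _.
move: (bA i) (gA i); rewrite /mergez ffunE finset.in_setC; case: (i \in A) => /=.
  by move=> _ /eqP ->; rewrite expr0 mulr1.
by move=> /eqP -> _; rewrite expr0 mul1r.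
Qed.

(** The polynomial in the variables off [A] that multiplies the monomial [b]; [partialc] holds the
    coefficients in the variables of [A] once the others are fixed to [y]. *)
Definition slice (R : realType) (I : finType) d (c : expo I d -> R[i]) (A : {set I})
    (b : expo I d) : expo I d -> R[i] :=
  fun g => if onset (~: A) g then c (mergex A b g) else 0.

Definition partialc (R : realType) (I : finType) d (c : expo I d -> R[i]) (A : {set I})
    (y : I -> R[i]) : expo I d -> R[i] :=
  fun b => if onset A b then peval (slice c A b) y else 0.

Lemma peval_partialc (R : realType) (I : finType) d (c : expo I d -> R[i]) (A : {set I})
    (x y : I -> R[i]) : peval (partialc c A y) x = peval c (mergez A x y).
Proof.
rewrite [RHS](sum_mergex A) /peval [RHS]big_mkcond/=; apply: eq_bigr => b _.
rewrite /partialc; case: ifP => bA; last by rewrite mul0r.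
rewrite /peval mulr_suml [RHS]big_mkcond/=; apply: eq_bigr => g _.
rewrite /slice; case: ifP => gA; last by rewrite !mul0r.
by rewrite mono_mergex//; ring.
Qed.

Definition unitbd (R : realType) (I : finType) d (c : expo I d -> R[i]) : Prop :=
  forall z, (forall i, cmod (z i) <= 1) -> cmod (peval c z) <= 1.

Lemma unitbd_partialc (R : realType) (I : finType) d (c : expo I d -> R[i]) (A : {set I})
    (y : I -> R[i]) : unitbd c -> (forall i, cmod (y i) <= 1) -> unitbd (partialc c A y).
Proof.
move=> c1 y1 x x1; rewrite peval_partialc; apply: c1 => i.
by rewrite /mergez; case: ifP.
Qed.

Lemma cmod_upt (R : realType) (I : finType) Q (zeta : R[i]) (w : {ffun I -> 'I_Q}) i :
  Q.-primitive_root zeta -> cmod (upt zeta w i) = 1.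
Proof. by move=> zP; rewrite cmodX (cmod_prim_root zP) expr1n. Qed.

(** Rotating the variable z_i by such a [v] makes the term of z_i^k nonnegative, so that the moduli
    of these coefficients add up in a single value of the polynomial. *)
Lemma phase_exists (R : realType) k (x : R[i]) : (0 < k)%N ->
  exists v, cmod v = 1 /\ x * v ^+ k = (cmod x)%:C%C.
Proof.
move=> k0; have [->|x0] := eqVneq x 0.
  by exists 1; rewrite Normc.normc1 Normc.normc0 mul0r.
have [v vE] := root_exists ((cmod x)%:C%C / x) k0.
have cx : cmod x != 0 by apply: contra x0 => /eqP/Normc.eq0_normc ->.
exists v; split; last by rewrite vE mulrCA mulfV// mulr1.
apply: (cmod_root1 k0); rewrite -cmodX vE Normc.normcM Normc.normcV.
have -> : cmod ((cmod x)%:C%C) = cmod x.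
  by rewrite /= expr0n/= addr0 sqrtr_sqr ger0_norm// cmod_ge0.
by rewrite mulfV.
Qed.

(* Among exponents of weight [k], those of [z_i ^ k]. *)
Definition diag (I : finType) d k : pred (expo I d) :=
  fun g => [exists i, g i == k :> nat].

Lemma diag_modn (I : finType) d k (g : expo I d) : (0 < k)%N -> wt g = k ->
  diag k g = [forall i, g i == 0 %[mod k]].
Proof.
move=> k0 gk; apply/existsP/forallP => [[i /eqP gi] j|g0].
  rewrite mod0n; have [->|ji] := eqVneq j i; first by rewrite gi modnn.
  move: gk; rewrite /wt (bigD1 i)//= gi (bigD1 j)//= -{2}[k]addn0 => /addnI/eqP.
  by rewrite addn_eq0 => /andP[/eqP -> _]; rewrite mod0n.
have [i gi] : exists i, (0 < g i)%N.
  apply/existsP; apply: contraPT gk => /existsPn gz.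
  rewrite /wt big1 => [|i _]; first by case: (k) k0.
  by apply/eqP; rewrite -leqn0 leqNgt.
exists i; rewrite eqn_leq; apply/andP; split.
  by rewrite -gk /wt (bigD1 i)//= leq_addr.
apply: dvdn_leq => //; by have := g0 i; rewrite mod0n.
Qed.

(* Averaging over independent [k]-th roots of unity keeps only the exponents divisible by [k]. *)
Lemma diag_coef_sum_le (R : realType) (I : finType) d k (c : expo I d -> R[i]) :
  unitbd c -> (0 < k)%N ->
  \sum_(g | (wt g == k) && diag k g) cmod (c g) <= 1.
Proof.
move=> c1 k0.
(* If [k > d], then [inord k] falls back to 0; but then no exponent is diagonal, and [single] is
   compared only with diagonal exponents. *)
pose single i : expo I d := [ffun j => if j == i then inord k else ord0].
have [v vP] := choice (fun i => phase_exists (c (single i)) k0).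
have [eta etaP] := prim_root_exists R k0.
pose Q := (#|I| * d + k).+1.
have [zeta zP] := @prim_root_exists R Q isT.
have hom1 z : (forall i, cmod (z i) <= 1) -> cmod (peval (homc k c) z) <= 1.
  move=> z1; apply: le_trans (cmod_peval_homc c z zP _ _) _; rewrite ?/Q; try lia.
  apply: avg_le => // t; apply: c1 => i.
  by rewrite Normc.normcM cmodX (cmod_prim_root zP) expr1n mul1r.
have K0 : (k ^ #|I|)%:R != 0 :> R[i] by rewrite pnatr_eq0 expn_eq0 negb_and -lt0n k0.
pose z (w : {ffun I -> 'I_k}) i := upt eta w i * v i.
have sumE : \sum_w peval (homc k c) (z w) = (k ^ #|I|)%:R *
    (\sum_(g | (wt g == k) && diag k g) cmod (c g))%:C%C.
  rewrite /peval exchange_big/= rmorph_sum/= mulr_sumr [RHS]big_mkcond/=.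
  apply: eq_bigr => g _; rewrite -mulr_sumr /homc.
  case: eqP => [gk|_]/=; last by rewrite mul0r.
  have -> : \sum_w mono (z w) g = mono v g * \prod_i \sum_(j < k)
      (eta ^+ g i) ^+ j * (((eta ^+ 0) ^+ j)^*)%C.
    rewrite bigA_distr_bigA mulr_sumr; apply: eq_bigr => w _.
    rewrite /mono -big_split/=; apply: eq_bigr => i _.
    by rewrite /z /upt expr0 expr1n conjc1 mulr1 exprMn exprAC mulrC.
  under eq_bigr do rewrite (sum_root_expr _ _ etaP).
  rewrite diag_modn//; case: ifPn => [/forallP g0|].
    under eq_bigr do rewrite g0.
    rewrite prodr_const natrX mulrA mulrC; congr (_ * _).
    have /existsP[i /eqP gi] : diag k g by rewrite diag_modn//; apply/forallP.
    have gE : g = single i.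
      apply/ffunP => j; apply/val_inj; rewrite ffunE; case: eqP => [->|/eqP ji].
        by rewrite /= inordK ?gi// -gi.
      move: gk; rewrite /wt (bigD1 i)//= gi (bigD1 j)//= -{2}[k]addn0 => /addnI/eqP.
      by rewrite addn_eq0 => /andP[/eqP -> _].
    rewrite gE -(proj2 (vP i)); congr (_ * _).
    rewrite -gE /mono (bigD1 i)//= gi big1 ?mulr1// => j ji.
    by rewrite gE ffunE (negPf ji) expr0.
  rewrite negb_forall => /existsP[i gi].
  by rewrite (bigD1 i)//= (negPf gi) mul0r !mulr0.
set S := \sum_(g | _) _ in sumE *.
have S0 : 0 <= S by apply: sumr_ge0 => g _; exact: cmod_ge0.
have : cmod (\sum_w peval (homc k c) (z w)) <= (k ^ #|I|)%:R.
  apply: le_trans (cmod_sum _ _) _.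
  apply: (@le_trans _ _ (\sum_(w : {ffun I -> 'I_k}) 1)).
    apply: ler_sum => w _; apply: hom1 => i.
    by rewrite Normc.normcM cmod_upt// (proj1 (vP i)) mulr1.
  by rewrite sumr_const card_ffun card_ord.
have -> : cmod (\sum_w peval (homc k c) (z w)) = (k ^ #|I|)%:R * S.
  rewrite sumE -(rmorph_nat (@real_complex R)) -rmorphM /=.
  by rewrite expr0n/= addr0 sqrtr_sqr ger0_norm// mulr_ge0.
by rewrite ger_pMr// ltr0n expn_gt0 k0.
Qed.

(* [|| a(F_k) ||_{q_k} ^ 2]; here and below [1 + 1/k] stands for [2 / q_k]. *)
Definition bh_norm2 (R : realType) (I : finType) d k (c : expo I d -> R[i]) : R :=
  (\sum_(g | wt g == k) cmod (c g) `^ bh_exp R k) `^ (1 + k%:R^-1).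

(** The induction statement. It is uniform in the number of variables and in the bound [d] on the
    exponents, and [N] limits only the degrees summed: [c] itself may have any degree, as is the
    case for the polynomials obtained by fixing y. *)
Definition bh_upto (R : realType) (K : R) (N : nat) : Prop :=
  forall n d (c : expo 'I_n d -> R[i]), unitbd c ->
    \sum_(1 <= k < N.+1) bh_norm2 k c / k%:R ^+ 10 <= K ^+ 2.

(** The square of the l^{q_k}(l^2) norm of the part of degree [k] on [A] and [l] off [A], since (1 +
    1/k)^-1 = q_k / 2. The predicate [P] allows the outer index to be restricted to pure powers. *)
Definition mixed (R : realType) (I : finType) d (P : pred (expo I d)) (c : expo I d -> R[i])
    (A : {set I}) (k l : nat) : R :=
  (\sum_(b | [&& P b, onset A b & wt b == k])
     (\sum_(g | onset (~: A) g && (wt g == l)) cmod (c (mergex A b g)) ^+ 2)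
        `^ (1 + k%:R^-1)^-1) `^ (1 + k%:R^-1).

Lemma inv1_gt0 (R : realType) k : 0 < 1 + k%:R^-1 :> R.
Proof. by rewrite ltr_pwDl// invr_ge0. Qed.

Lemma inv1_ge1 (R : realType) k : 1 <= 1 + k%:R^-1 :> R.
Proof. by rewrite lerDl invr_ge0. Qed.

Lemma mixed_ge0 (R : realType) (I : finType) d (P : pred (expo I d)) (c : expo I d -> R[i])
    (A : {set I}) (k l : nat) : 0 <= mixed P c A k l.
Proof. exact: powR_ge0. Qed.

(** Minkowski with exponent 2/q_k moves the sum over [l] inside the sum over [b], where
    hypercontractivity of the slice in y absorbs it; Jensen then brings the power inside the
    average. [Q0] is chosen before [k], so one root of unity serves all degrees. *)
Lemma sum_mixed_le (R : realType) (I : finType) d :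
  exists Q0, forall Q (zeta : R[i]) k L (P : pred (expo I d)) (c : expo I d -> R[i])
    (A : {set I}),
  (Q0 < Q)%N -> Q.-primitive_root zeta -> (0 < k)%N ->
  \sum_(l < L) 4 `^ (- (l%:R / k%:R)) * mixed P c A k l <=
  2 * avg (fun w : {ffun I -> 'I_Q} =>
    (\sum_(b | P b && (wt b == k)) cmod (partialc c A (upt zeta w) b) `^ bh_exp R k)
       `^ (1 + k%:R^-1)).
Proof.
have [Q0 hyp] := hypercontractive R I d; exists Q0 => Q zeta k L P c A QQ zP k0.
set s := 1 + k%:R^-1; have s0 : 0 < s := inv1_gt0 R k.
have s1 : 1 <= s := inv1_ge1 R k.
have sn : s != 0 by rewrite gt_eqF.
pose T b := [&& P b, onset A b & wt b == k].
pose B b l := \sum_(g | onset (~: A) g && (wt g == l)) cmod (c (mergex A b g)) ^+ 2.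
have B0 b l : 0 <= B b l by apply: sumr_ge0 => g _; exact: sqr_ge0.
pose D (l : nat) : R := 4 `^ (- (l%:R / k%:R)).
have D0 l : 0 <= D l by exact: powR_ge0.
have DB0 b l : 0 <= D l * B b l by rewrite mulr_ge0.
pose t (l : 'I_L) b := (D l * B b l) `^ s^-1.
have t0 l b : 0 <= t l b by exact: powR_ge0.
have lhsE : \sum_(l < L) D l * mixed P c A k l =
    \sum_(l < L) (\sum_(b | T b) t l b) `^ s.
  apply: eq_bigr => l _; rewrite /mixed -/s.
  have -> : D l = (D l `^ s^-1) `^ s by rewrite -powRrM mulVf// powRr1.
  rewrite -powRM ?powR_ge0 ?sumr_ge0// => [|b _]; last exact: powR_ge0.
  by rewrite mulr_sumr; congr (_ `^ _); apply: eq_bigr => b _; rewrite /t powRM.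
rewrite -/(D _) lhsE; apply: le_trans (minkowski_sum _ _ s1 t0) _.
pose n b := avg (fun w : {ffun I -> 'I_Q} => cmod (peval (slice c A b) (upt zeta w)) `^ bh_exp R k).
have n0 b : 0 <= n b by apply: avg_ge0 => w; exact: powR_ge0.
have DBn b : \sum_(l < L) D l * B b l <= 2 * n b `^ s.
  apply: le_trans (hyp Q zeta k (slice c A b) QQ zP k0).
  pose x g := 4 `^ (- ((wt g)%:R / k%:R)) * cmod (slice c A b g) ^+ 2.
  have x0 g : 0 <= x g by rewrite mulr_ge0 ?powR_ge0 ?sqr_ge0.
  rewrite [leLHS](_ : _ = \sum_(l < L) \sum_(g | wt g == l) x g).
    rewrite (exchange_big_dep predT)//= /damped; apply: ler_sum => g _; rewrite -/(x g).
    have [gL|gL] := ltnP (wt g) L.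
      rewrite (bigD1 (Ordinal gL))//= big1 ?addr0// => l /andP[/eqP gl /eqP[]].
      exact/val_inj.
    by rewrite big_pred0// => l; apply: contraTF gL => /eqP ->; rewrite -ltnNge.
  apply: eq_bigr => l _; rewrite /B mulr_sumr big_mkcond [RHS]big_mkcond/=.
  apply: eq_bigr => g _; rewrite /x /slice.
  case: (onset _ _); first by rewrite /=; case: eqP => // ->.
  by rewrite Normc.normc0 expr0n mulr0 if_same.
apply: (@le_trans _ _ ((\sum_(b | T b) (2 `^ s^-1 * n b)) `^ s)).
  apply: ge0_ler_powR.
  - exact: ltW.
  - by rewrite nnegrE sumr_ge0// => b _; exact: powR_ge0.
  - by rewrite nnegrE sumr_ge0// => b _; rewrite mulr_ge0 ?powR_ge0.
  apply: ler_sum => b _; under eq_bigr do rewrite /t -powRrM mulVf// powRr1//.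
  have -> : 2 `^ s^-1 * n b = (2 * n b `^ s) `^ s^-1.
    by rewrite powRM ?powR_ge0// -powRrM mulfV// powRr1.
  apply: ge0_ler_powR; first by rewrite invr_ge0 ltW.
  - by rewrite nnegrE sumr_ge0.
  - by rewrite nnegrE mulr_ge0 ?powR_ge0.
  exact: DBn.
rewrite -mulr_sumr powRM ?powR_ge0 ?sumr_ge0// -powRrM mulVf// powRr1//.
apply: ler_wpM2l => //.
rewrite /n -avg_sum.
have V0 (w : {ffun I -> 'I_Q}) : 0 <= \sum_(b | T b) cmod (peval (slice c A b) (upt zeta w)) `^ bh_exp R k.
  by apply: sumr_ge0 => b _; exact: powR_ge0.
apply: le_trans (jensen_avg s1 V0) _; apply: ler_avg => w.
apply: ge0_ler_powR.
- exact: ltW.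
- by rewrite nnegrE V0.
- by rewrite nnegrE sumr_ge0// => b _; exact: powR_ge0.
rewrite big_mkcond [leRHS]big_mkcond/=; apply: ler_sum => b _.
rewrite /T /partialc; case: (P b) => //=; case: (onset A b) => //=.
by case: ifP => // _; exact: powR_ge0.
Qed.

Lemma big_nat_ord1 (V : nmodType) N (F : nat -> V) :
  \sum_(1 <= k < N.+1) F k = \sum_(k < N) F k.+1.
Proof. by rewrite big_add1/= big_mkord. Qed.

(** For each fixed y on the torus the polynomial in x is again bounded by 1, so the induction
    statement holds pointwise under the average. The sums over both degrees cost only the factor 2
    of hypercontractivity. *)
Lemma bh_upto_mixed (R : realType) (K : R) N n d (c : expo 'I_n d -> R[i]) (A : {set 'I_n}) L :
  bh_upto K N -> unitbd c ->
  \sum_(1 <= k < N.+1) \sum_(l < L)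
     4 `^ (- (l%:R / k%:R)) * mixed predT c A k l / k%:R ^+ 10 <= 2 * K ^+ 2.
Proof.
move=> SN c1; have [Q0 H] := sum_mixed_le R 'I_n d.
have [zeta zP] := @prim_root_exists R Q0.+1 isT.
pose f k (w : {ffun 'I_n -> 'I_Q0.+1}) := bh_norm2 k (partialc c A (upt zeta w)) / k%:R ^+ 10.
apply: (@le_trans _ _ (2 * avg (fun w => \sum_(1 <= k < N.+1) f k w))).
  rewrite (_ : (fun w => _) = (fun w => \sum_(k < N) f k.+1 w)); last first.
    by apply/funext => w; rewrite big_nat_ord1.
  rewrite avg_sum mulr_sumr big_nat_ord1; apply: ler_sum => k _.
  rewrite -mulr_suml /f; rewrite ler_pdivrMr ?exprn_gt0//.
  have -> : avg (fun w : {ffun 'I_n -> 'I_Q0.+1} => bh_norm2 k.+1 (partialc c A (upt zeta w)) / k.+1%:R ^+ 10) =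
      (k.+1%:R ^+ 10)^-1 * avg (fun w : {ffun 'I_n -> 'I_Q0.+1} => bh_norm2 k.+1 (partialc c A (upt zeta w))).
    by rewrite -[RHS]avgZ; congr avg; apply/funext => w; rewrite mulrC.
  have E (a x : R) : x != 0 -> 2 * (x^-1 * a) * x = 2 * a by move=> x0; field.
  rewrite E ?expf_neq0 ?pnatr_eq0//.
  exact: (H Q0.+1 zeta k.+1 L predT c A (ltnSn _) zP isT).
rewrite ler_wpM2l//; apply: avg_le; first exact: sqr_ge0.
move=> w; apply: SN; apply: unitbd_partialc => // i.
by rewrite cmod_upt.
Qed.

(** On pure powers the l^1 bound of [diag_coef_sum_le] replaces the induction statement:
    coefficients of modulus at most 1 only decrease when raised to q_k >= 1. Hence [K] does not
    occur, and [k] may be as large as the degree being treated. *)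
Lemma mixed_diag_le (R : realType) n d (c : expo 'I_n d -> R[i]) (A : {set 'I_n}) k l :
  unitbd c -> (0 < k)%N -> mixed (diag k) c A k l <= 2 * 4 `^ (l%:R / k%:R).
Proof.
move=> c1 k0; have [Q0 H] := sum_mixed_le R 'I_n d.
have [zeta zP] := @prim_root_exists R Q0.+1 isT.
have := H _ zeta k l.+1 (diag k) c A (ltnSn _) zP k0.
set a := avg _ => Ha.
have a1 : a <= 1.
  apply: avg_le => // w.
  rewrite [leRHS](_ : 1 = 1 `^ (1 + k%:R^-1)); last by rewrite powR1.
  apply: ge0_ler_powR.
  - exact/ltW/inv1_gt0.
  - by rewrite nnegrE sumr_ge0// => b _; exact: powR_ge0.
  - by rewrite nnegrE.
  have c1' : unitbd (partialc c A (upt zeta w)).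
    by apply: unitbd_partialc => // i; rewrite cmod_upt.
  have D1 := diag_coef_sum_le c1' k0.
  apply: le_trans D1; rewrite (eq_bigl (fun b => (wt b == k) && diag k b)); last first.
    by move=> b; rewrite andbC.
  apply: ler_sum => b /andP[bk bd].
  set x := cmod _; have x0 : 0 <= x by exact: cmod_ge0.
  have x1 : x <= 1.
    apply: le_trans (diag_coef_sum_le c1' k0); rewrite (bigD1 b) ?bk//= lerDl.
    by apply: sumr_ge0 => *; exact: cmod_ge0.
  have [->|xn] := eqVneq x 0; first by rewrite powR0// gt_eqF// bh_exp_gt0.
  by apply: ge1r_powR; rewrite ?bh_exp_ge1// x1 lt_def xn x0.
have : 4 `^ (- (l%:R / k%:R)) * mixed (diag k) c A k l <= 2.
  apply: le_trans (le_trans Ha _); last by lra.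
  rewrite (bigD1 (Ordinal (ltnSn l)))//= lerDl sumr_ge0// => i _.
  by rewrite mulr_ge0 ?powR_ge0.
by rewrite powRN ler_pdivrMl ?powR_gt0// mulrC.
Qed.

(* Blei's inequality, for the exponents [bh_exp R k / 2 = (1 + 1/k)^-1]. *)
Lemma blei_sum (R : realType) (I J : finType) (P : pred I) (S : pred J) (b : I -> J -> R)
    (k l : nat) :
  (0 < k)%N -> (0 < l)%N -> (forall i j, 0 <= b i j) ->
  \sum_(i | P i) \sum_(j | S j) b i j `^ (1 + (k + l)%:R^-1)^-1 <=
  (((\sum_(i | P i) (\sum_(j | S j) b i j) `^ (1 + k%:R^-1)^-1) `^ (1 + k%:R^-1))
       `^ (k%:R / (k + l)%:R) *
   ((\sum_(j | S j) (\sum_(i | P i) b i j) `^ (1 + l%:R^-1)^-1) `^ (1 + l%:R^-1))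
       `^ (l%:R / (k + l)%:R)) `^ (1 + (k + l)%:R^-1)^-1.
Proof.
move=> k0 l0 b0; rewrite natrD.
have kp : 0 < k%:R :> R by rewrite ltr0n.
have lp : 0 < l%:R :> R by rewrite ltr0n.
set x : R := k%:R in kp *; set y : R := l%:R in lp *.
(* [t] is the Hoelder parameter for the inner sum over [j], interpolating between the exponents 1
   and y/(y+1); [t'] is the one for the outer sum over [i], between x/(x+1) for [f] and (y+1)/y for
   [g]. *)
pose t := x / (x + y + 1); pose t' := (x + 1) / (x + y + 1).
have xy1 : 0 < x + y + 1 by lra.
have t01 : 0 < t <= 1 by rewrite divr_gt0//= ler_pdivrMr//; lra.
have t01' : 0 < t' <= 1 by rewrite divr_gt0//= ?ler_pdivrMr//; lra.
pose f i := \sum_(j | S j) b i j.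
pose g i := \sum_(j | S j) b i j `^ (1 + y^-1)^-1.
have f0 i : 0 <= f i by exact: sumr_ge0.
have g0 i : 0 <= g i by apply: sumr_ge0 => j _; exact: powR_ge0.
have split_pow i j : b i j `^ (1 + (x + y)^-1)^-1 =
    b i j `^ t * (b i j `^ (1 + y^-1)^-1) `^ (1 - t).
  rewrite -powRrM -powRD.
    by congr (_ `^ _); rewrite /t; field; lra.
  apply/implyP => /eqP E; suff : 0 < t + (1 + y^-1)^-1 * (1 - t) by rewrite E ltxx.
  move: t01 => /andP[t_gt0 t_le1]; by rewrite ltr_pwDl// mulr_ge0// ?subr_ge0// invr_ge0 addr_ge0// invr_ge0 ltW.
apply: (@le_trans _ _ (\sum_(i | P i) f i `^ t * g i `^ (1 - t))).
  apply: ler_sum => i _; under eq_bigr do rewrite split_pow.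
  by apply: hoelder_sum => // j; exact: powR_ge0.
set X := \sum_(i | P i) _ `^ (1 + x^-1)^-1; set Y := (\sum_(j | S j) _) `^ (1 + y^-1).
have X0 : 0 <= X by apply: sumr_ge0 => i _; exact: powR_ge0.
have Y0 : 0 <= Y by exact: powR_ge0.
(* Minkowski exchanges the order of the two sums, which turns this factor into the mixed norm with
   [j] outside. *)
have Yge : \sum_(i | P i) g i `^ (1 + y^-1) <= Y.
  have y1 : 1 <= 1 + y^-1 by rewrite lerDl invr_ge0 ltW.
  apply: le_trans (@minkowski_sum R I J P S (fun i j => b i j `^ (1 + y^-1)^-1) _ y1 _) _.
    by move=> i j; exact: powR_ge0.
  rewrite le_eqVlt; apply/orP; left; apply/eqP; congr (_ `^ _).
  apply: eq_bigr => j _; congr (_ `^ _); apply: eq_bigr => i _.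
  by rewrite -powRrM mulVf ?powRr1// gt_eqF//; lra.
apply: (@le_trans _ _ (X `^ t' * (\sum_(i | P i) g i `^ (1 + y^-1)) `^ (1 - t'))).
  apply: le_trans (@hoelder_sum R I P (fun i => f i `^ (1 + x^-1)^-1)
     (fun i => g i `^ (1 + y^-1)) t' t01' _ _); last 2 first.
  - by move=> i; exact: powR_ge0.
  - by move=> i; exact: powR_ge0.
  rewrite le_eqVlt; apply/orP; left; apply/eqP; apply: eq_bigr => i _.
  by rewrite -!powRrM; congr (_ `^ _ * _ `^ _); rewrite /t /t'; field; lra.
clearbody X Y.
rewrite (powRM _ (powR_ge0 _ _) (powR_ge0 _ _)) -!powRrM.
have -> : (1 + x^-1) * (x / (x + y) * (1 + (x + y)^-1)^-1) = t' by rewrite /t'; field; lra.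
have -> : y / (x + y) * (1 + (x + y)^-1)^-1 = 1 - t' by rewrite /t'; field; lra.
apply: ler_wpM2l; first exact: powR_ge0.
apply: ge0_ler_powR Yge; rewrite ?nnegrE.
- by move: t01' => /andP[_]; rewrite subr_ge0.
- by apply: sumr_ge0 => i _; exact: powR_ge0.
- exact: Y0.
Qed.

Lemma mixed_blei (R : realType) (I : finType) d (P : pred (expo I d)) (c : expo I d -> R[i])
    (A : {set I}) (k l : nat) :
  (0 < k)%N -> (0 < l)%N ->
  \sum_(b | [&& P b, onset A b & wt b == k]) \sum_(g | onset (~: A) g && (wt g == l))
     cmod (c (mergex A b g)) `^ bh_exp R (k + l) <=
  (mixed P c A k l `^ (k%:R / (k + l)%:R) * mixed predT c (~: A) l k `^ (l%:R / (k + l)%:R))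
     `^ (1 + (k + l)%:R^-1)^-1.
Proof.
move=> k0 l0.
have kl0 : (0 < k + l)%N by rewrite addn_gt0 k0.
have E (x : R) : 0 <= x -> x `^ bh_exp R (k + l) = (x ^+ 2) `^ (1 + (k + l)%:R^-1)^-1.
  move=> x0; rewrite -powR_mulrn// -powRrM; congr (_ `^ _).
  by rewrite -(bh_expM R kl0) mulfK// gt_eqF// inv1_gt0.
under eq_bigr do under eq_bigr do rewrite E ?cmod_ge0//.
apply: le_trans (blei_sum _ _ k0 l0 _) _ => [b g|]; first exact: sqr_ge0.
apply: ge0_ler_powR.
- by rewrite invr_ge0 ltW ?inv1_gt0.
- by rewrite nnegrE mulr_ge0 ?powR_ge0.
- by rewrite nnegrE mulr_ge0 ?powR_ge0.
apply: ler_wpM2l; first exact: powR_ge0.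
apply: ge0_ler_powR.
- by rewrite divr_ge0.
- by rewrite nnegrE powR_ge0.
- by rewrite nnegrE mixed_ge0.
apply: ge0_ler_powR; rewrite ?nnegrE.
- by rewrite ltW ?inv1_gt0.
- by apply: sumr_ge0 => g _; exact: powR_ge0.
- by apply: sumr_ge0 => g _; exact: powR_ge0.
apply: ler_sum => g _; apply: ge0_ler_powR; rewrite ?nnegrE.
- by rewrite invr_ge0 ltW ?inv1_gt0.
- by apply: sumr_ge0 => b _; exact: sqr_ge0.
- by apply: sumr_ge0 => b _; exact: sqr_ge0.
rewrite finset.setCK big_mkcond [leRHS]big_mkcond/=; apply: ler_sum => b _.
rewrite mergexC; case: (P b) => //=; case: ifP => // _; exact: sqr_ge0.
Qed.

Lemma card_sets (T : finType) : #|{set T}| = (2 ^ #|T|)%N.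
Proof. by rewrite -(cardsT T) -card_powerset; apply: eq_card => A; rewrite !inE finset.subsetT. Qed.

(** * Random sets of variables *)

Definition balanced (r k : nat) : bool := (r <= 4 * k <= 3 * r)%N.

(** Put d_i = (x_i - y_i)/2, so |d_i| <= r/4; balance means |d3 +- d1 +- d2| <= r/4. Let d3 >= 0 and
    |d1| >= |d2|. Then d3 - |d1| + |d2| always qualifies. If both d3 + |d1| - |d2| and d3 - |d1| -
    |d2| failed, adding the two inequalities would give |d1| > r/4. *)
Lemma balanced_flips (r x1 y1 x2 y2 x3 y3 : nat) :
  (2 * (x1 + y1) <= r)%N -> (2 * (x2 + y2) <= r)%N -> (2 * (x3 + y3) <= r)%N ->
  (x1 + y1 + (x2 + y2) + (x3 + y3) = r)%N ->
  (2 <= balanced r (x1 + x2 + x3) + balanced r (y1 + x2 + x3) +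
        balanced r (x1 + y2 + x3) + balanced r (y1 + y2 + x3))%N.
Proof.
rewrite /balanced => h1 h2 h3 h.
case: (boolP (_ <= 4 * (x1 + x2 + x3) <= _)%N) => a1;
case: (boolP (_ <= 4 * (y1 + x2 + x3) <= _)%N) => a2;
case: (boolP (_ <= 4 * (x1 + y2 + x3) <= _)%N) => a3;
case: (boolP (_ <= 4 * (y1 + y2 + x3) <= _)%N) => a4 //=; exfalso; lia.
Qed.

Definition flip (I : finType) (T A : {set I}) : {set I} := [set i | (i \in A) (+) (i \in T)].

Lemma flipK (I : finType) (T : {set I}) : involutive (flip T).
Proof. by move=> A; apply/setP => i; rewrite !inE -addbA addbb addbF. Qed.

Lemma wt_restx (I : finType) d (A : {set I}) (a : expo I d) :
  wt (restx A a) = (\sum_(i in A) a i)%N.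
Proof. by rewrite /wt [RHS]big_mkcond; apply: eq_bigr => i _; rewrite ffunE; case: ifP. Qed.

Lemma big_ord3 n (i0 : 'I_n) (F : 'I_n -> nat) :
  (\sum_i F i = \sum_(i < n | i < i0) F i + F i0 + \sum_(i < n | i0 < i) F i)%N.
Proof.
rewrite (bigID (fun i : 'I_n => i < i0)%N)/= -addnA; congr (_ + _)%N.
rewrite (bigD1 i0) ?ltnn//=; congr (_ + _)%N; apply: eq_bigl => i.
by rewrite -leqNgt ltn_neqAle andbC eq_sym.
Qed.

(* The pivot is where the partial sums of [a] cross half of the total weight. *)
Lemma pivot_exists n d (a : expo 'I_n d) :
  (0 < wt a)%N -> exists i0 : 'I_n,
    (2 * (\sum_(i < n | i < i0) a i) <= wt a)%N /\
    (2 * (\sum_(i < n | i0 < i) a i) <= wt a)%N.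
Proof.
move=> a0; pose p m := (\sum_(i < n | i < m) a i)%N.
have pn : p n = wt a by apply: eq_bigl => i; rewrite ltn_ord.
have ex : exists m, (wt a < 2 * p m)%N by exists n; rewrite pn; lia.
case: (ex_minnP ex) => m mP minm.
have mn : (m <= n)%N by apply: minm; rewrite pn; lia.
case: m => [|m] in mP minm mn *.
  by move: mP; rewrite /p big_pred0 ?muln0.
pose i0 := Ordinal mn; exists i0.
have pm : (2 * p m <= wt a)%N.
  by rewrite leqNgt; apply/negP => /minm; rewrite ltnn.
split=> //.
have := big_ord3 i0 (fun i => a i : nat); rewrite -/(wt a) -/(p m) => E.
have pS : p m.+1 = (p m + a i0)%N.
  rewrite /p (bigD1 i0)//= addnC; congr (_ + _)%N; apply: eq_bigl => i.
  by rewrite ltnS ltn_neqAle andbC.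
by move: mP E; rewrite pS; lia.
Qed.

(** The sets are grouped by flipping membership below the pivot and at the pivot. Each flip is a
    bijection on sets, and at least two of the four flips of any set are balanced. The hypothesis on
    single exponents is what bounds the block of the pivot itself. *)
Lemma card_balanced n d (a : expo 'I_n d) :
  (0 < wt a)%N -> (forall i, 2 * a i <= wt a)%N ->
  (2 ^ n <= 2 * \sum_(A : {set 'I_n}) balanced (wt a) (wt (restx A a)))%N.
Proof.
move=> a0 ale; have [i0 [h1 h3]] := pivot_exists a0.
pose ok (A : {set 'I_n}) : nat := balanced (wt a) (wt (restx A a)).
pose T (e1 e2 : bool) : {set 'I_n} := [set i : 'I_n | ((i < i0)%N && e1) || ((i == i0) && e2)].
have okT e1 e2 : (\sum_(A : {set 'I_n}) ok A = \sum_(A : {set 'I_n}) ok (flip (T e1 e2) A))%N.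
  by rewrite (reindex_inj (inv_inj (flipK (T e1 e2)))).
change (2 ^ n <= 2 * \sum_(A : {set 'I_n}) ok A)%N.
suff : (2 * 2 ^ n <= \sum_(A : {set 'I_n}) ok A + \sum_(A : {set 'I_n}) ok A + \sum_(A : {set 'I_n}) ok A + \sum_(A : {set 'I_n}) ok A)%N by lia.
rewrite {1}(okT false false) {1}(okT true false) {1}(okT false true) {1}(okT true true).
rewrite -!big_split/=.
have -> : (2 * 2 ^ n = \sum_(A : {set 'I_n}) 2)%N.
  by rewrite sum_nat_const card_sets card_ord mulnC.
apply: leq_sum => A _.
pose F e1 e2 (i : 'I_n) : nat := if i \in flip (T e1 e2) A then (a i : nat) else 0%N.
have wtF e1 e2 : wt (restx (flip (T e1 e2) A) a) = (\sum_i F e1 e2 i)%N.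
  by rewrite wt_restx big_mkcond.
have Flt e1 e2 : (\sum_(i < n | i < i0) F e1 e2 i =
    \sum_(i < n | i < i0) if (if e1 then i \notin A else i \in A) then (a i : nat) else 0)%N.
  apply: eq_bigr => i ii0; rewrite /F !inE ii0 /=.
  rewrite (_ : i == i0 = false); first by case: e1; rewrite ?orbF ?addbT ?addbF.
  by apply/negbTE; rewrite neq_ltn ii0.
have Fgt e1 e2 : (\sum_(i < n | i0 < i) F e1 e2 i =
    \sum_(i < n | i0 < i) if i \in A then (a i : nat) else 0)%N.
  apply: eq_bigr => i ii0; rewrite /F !inE ltnNge (ltnW ii0) /=.
  by rewrite (_ : i == i0 = false) ?addbF//; apply/negbTE; rewrite neq_ltn ii0 orbT.
have Feq e1 e2 : F e1 e2 i0 = if (if e2 then i0 \notin A else i0 \in A) then (a i0 : nat) else 0%N.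
  by rewrite /F !inE ltnn eqxx /=; case: e2; rewrite ?addbT ?addbF.
have split_if (b : bool) (m : nat) : ((if b then m else 0) + (if ~~ b then m else 0) = m)%N.
  by case: b; rewrite ?addn0.
rewrite /ok !wtF !(big_ord3 i0) !Flt !Fgt !Feq /=.
apply: (@balanced_flips _ _ _ _ _ _ (\sum_(i < n | i0 < i) if i \notin A then (a i : nat) else 0)%N).
- by rewrite -big_split/=; under eq_bigr do rewrite split_if.
- by rewrite split_if.
- by rewrite -big_split/=; under eq_bigr do rewrite split_if.
- rewrite -!big_split/= split_if.
  under eq_bigr do rewrite split_if.
  under [X in (_ + X)%N]eq_bigr do rewrite split_if.
  by rewrite -(big_ord3 i0 (fun i => a i : nat)).
Qed.

(** Double counting: a term caught by a random event of probability at least [p] is recovered on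
    average at the cost of 1/p. [D'] lets the condition that guarantees this probability be dropped
    afterwards. *)
Lemma sum_le_avg (R : realType) (T U : finType) (D D' : pred U) (E : T -> pred U)
    (F : U -> R) (p : R) :
  0 < p -> (forall u, 0 <= F u) -> (forall u, D u -> D' u) ->
  (forall u, D u -> p <= avg (fun t => (E t u)%:R)) ->
  \sum_(u | D u) F u <= p^-1 * avg (fun t => \sum_(u | D' u && E t u) F u).
Proof.
move=> p0 F0 DD' DE; rewrite ler_pdivlMl// mulr_sumr.
apply: (@le_trans _ _ (\sum_(u | D' u) F u * avg (fun t => (E t u)%:R))).
  rewrite big_mkcond [leRHS]big_mkcond/=; apply: ler_sum => u _.
  case: ifP => [Du|_]; first by rewrite DD'// mulrC ler_wpM2l ?DE.
  by case: ifP => // _; rewrite mulr_ge0// avg_ge0// => t; rewrite ler0n.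
rewrite le_eqVlt; apply/orP; left; apply/eqP.
under eq_bigr do rewrite -avgZ; rewrite -avg_sum; congr avg; apply/funext => t.
rewrite big_mkcondr/=; apply: eq_bigr => u _.
by case: (E t u); rewrite ?mulr1 ?mulr0.
Qed.

Lemma sum_restx (V : nmodType) (I : finType) d (A : {set I}) (B : pred (expo I d)) r
    (F : expo I d -> V) :
  \sum_(a | (wt a == r) && B (restx A a)) F a =
  \sum_(k < r.+1) \sum_(b | [&& (wt b == k) && B b, onset A b & wt b == k])
    \sum_(g | onset (~: A) g && (wt g == (r - k)%N)) F (mergex A b g).
Proof.
rewrite big_mkcond (sum_mergex A)/=.
transitivity (\sum_(k < r.+1) \sum_(b | onset A b) if wt b == k then
    \sum_(g | onset (~: A) g) if (wt g == (r - k)%N) && B b then F (mergex A b g) else 0 else 0).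
  rewrite [RHS]exchange_big/=; apply: eq_bigr => b bA.
  have [bw|bw] := ltnP (wt b) r.+1; last first.
    rewrite [RHS]big1 => [|k _]; last first.
      by rewrite ifN//; apply: contraTneq bw => ->; rewrite -ltnNge ltn_ord.
    rewrite big1// => g gA; rewrite wt_mergex// ifN// negb_and; apply/orP; left.
    by apply: contraTneq bw => <-; rewrite -leqNgt leq_addr.
  rewrite (bigD1 (Ordinal bw))//= eqxx [X in _ = _ + X]big1 ?addr0 => [|k /eqP kb]; last first.
    by rewrite ifN//; apply/eqP => E; apply: kb; apply/val_inj.
  apply: eq_bigr => g gA; rewrite wt_mergex// restx_mergexl//.
  congr (if _ && _ then _ else _); apply/eqP/eqP; lia.
apply: eq_bigr => k _; rewrite big_mkcond [RHS]big_mkcond/=; apply: eq_bigr => b _.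
case: (onset A b) => /=; last by rewrite andbF.
case: eqP => //= _; rewrite andbT; case: (B b) => /=.
  by rewrite big_mkcondr/=; apply: eq_bigr => g _; rewrite andbT.
by rewrite big1// => g _; rewrite andbF.
Qed.

Lemma avg_prod (R : realType) (I J : finType) (f : I -> J -> R) :
  avg (fun w : {ffun I -> J} => \prod_i f i (w i)) = \prod_i avg (f i).
Proof.
rewrite /avg big_split/= prodr_const bigA_distr_bigA card_ffun natrX exprVn.
by rewrite cardE.
Qed.

Lemma prod_1subr_ge (R : realType) (I : finType) (P : pred I) (x : I -> R) :
  (forall i, 0 <= x i <= 1) ->
  1 - \sum_(i | P i) x i <= \prod_(i | P i) (1 - x i).
Proof.
move=> x01.
suff : 1 - \sum_(i | P i) x i <= \prod_(i | P i) (1 - x i) /\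
  0 <= \prod_(i | P i) (1 - x i) <= 1 by case.
elim/big_rec2: _ => [|i p s _ [IH1 /andP[IH2 IH3]]]; first by rewrite subr0 lexx ler01.
have /andP[xi0 xi1] := x01 i; split; first by nra.
by apply/andP; split; [rewrite mulr_ge0// subr_ge0 | nra].
Qed.

(* One colour class of a uniform colouring: a random set of density [1 / s.+1]. *)
Definition colset n s (w : {ffun 'I_n -> 'I_s.+1}) : {set 'I_n} := [set j | w j == ord0].

Definition dominated n d (a : expo 'I_n d) : bool := [exists i, wt a < 2 * a i]%N.

Definition pointed n d (r : nat) (b : expo 'I_n d) : bool :=
  diag (wt b) b && (r < 2 * wt b)%N.

(** With r = [wt a], the dominating variable is selected with probability 1/(2r). Independently, at
    most r other variables occur in [a], and by the union bound they are all avoided with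
    probability at least 1/2. *)
Lemma avg_pointed (R : realType) n d s (a : expo 'I_n d) :
  dominated a -> s.+1 = (2 * wt a)%N ->
  (4 * wt a)%:R^-1 <= avg (fun w : {ffun 'I_n -> 'I_s.+1} =>
     (pointed (wt a) (restx (colset w) a))%:R : R).
Proof.
move=> /existsP[i ai] sE.
pose f (j : 'I_n) (c : 'I_s.+1) : R :=
  if j == i then (c == ord0)%:R else ((a j == ord0) || (c != ord0))%:R.
have s0 : 0 < s.+1%:R :> R by rewrite ltr0n.
apply: (@le_trans _ _ (avg (fun w : {ffun 'I_n -> 'I_s.+1} => \prod_j f j (w j)))); last first.
  apply: ler_avg => w.
  have [/forallP all1|/forallPn[j]] := boolP [forall j, if j == i then w j == ord0
      else (a j == ord0) || (w j != ord0)]; last first.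
    move=> fj; rewrite (bigD1 j)//= /f; case: ifP fj => _ /negPf ->; rewrite mul0r; exact: ler0n.
  have -> : pointed (wt a) (restx (colset w) a).
    have rj j : j != i -> restx (colset w) a j = ord0.
      move=> /negPf ji; have := all1 j; rewrite ji ffunE inE.
      by case: (w j == ord0) => //=; rewrite orbF => /eqP.
    have ri : restx (colset w) a i = a i.
      by have := all1 i; rewrite eqxx ffunE inE => ->.
    have wtr : wt (restx (colset w) a) = a i.
      by rewrite /wt (bigD1 i)//= ri big1 ?addn0// => j ji; rewrite rj.
    by rewrite /pointed wtr ai andbT; apply/existsP; exists i; rewrite ri.
  have -> : \prod_j f j (w j) = 1; last by [].
  apply: big1 => j _; rewrite /f; have := all1 j; case: ifP => _ -> //.
rewrite avg_prod (bigD1 i)//=.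
have -> : avg (f i) = s.+1%:R^-1.
  rewrite /avg card_ord (bigD1 ord0)//= big1 /f ?eqxx ?addr0 ?mulr1// => c /negPf ->.
  by [].
have fj j : j != i -> avg (f j) = 1 - (a j != ord0)%:R / s.+1%:R.
  move=> /negPf ji; rewrite /avg card_ord /f ji.
  case: eqP => /= _.
    by rewrite sumr_const card_ord mulVf ?gt_eqF// mul0r subr0.
  rewrite (eq_bigr (fun c : 'I_s.+1 => 1 - (c == ord0)%:R)); last first.
    by move=> c _; case: (c == ord0) => /=; rewrite ?subrr ?subr0.
  rewrite sumrB sumr_const card_ord (bigD1 ord0)//= big1 ?addr0 => [|c /negPf ->//].
  by rewrite mulrBr mulVf ?gt_eqF// mulr1 mul1r.
rewrite (eq_bigr _ fj).
have x01 (j : 'I_n) : 0 <= ((a j != ord0)%:R / s.+1%:R : R) <= 1.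
  apply/andP; split; first by rewrite divr_ge0.
  rewrite ler_pdivrMr// mul1r ler_nat.
  by case: (_ != _).
apply: (@le_trans _ _ (s.+1%:R^-1 * 2^-1)).
  by have -> : (4 * wt a = s.+1 * 2)%N; [rewrite sE; lia | rewrite natrM invfM].
apply: ler_wpM2l; first by rewrite invr_ge0 ltW.
apply: le_trans (prod_1subr_ge _ x01).
suff : \sum_(j < n | j != i) (a j != ord0)%:R / s.+1%:R <= 2^-1 :> R by lra.
rewrite -mulr_suml ler_pdivrMr// -natr_sum sE natrM mulKf ?pnatr_eq0// ler_nat.
rewrite /wt [leqRHS](bigD1 i)//=; apply: leq_trans (leq_addl _ _).
by apply: leq_sum => j _; case: eqP => //= /eqP aj; rewrite lt0n.
Qed.

(** * The induction on the degree *)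

Lemma powR_inv_le (R : realType) (x y : R) r :
  (0 < r)%N -> 0 <= x -> 0 <= y -> x <= y ^+ r -> x `^ r%:R^-1 <= y.
Proof.
move=> r0 x0 y0 xy; have -> : y = (y ^+ r) `^ r%:R^-1.
  by rewrite -powR_mulrn// -powRrM mulfV ?powRr1// pnatr_eq0 -lt0n.
by apply: ge0_ler_powR; rewrite ?invr_ge0 ?nnegrE ?exprn_ge0.
Qed.

(** Normalised so that [bh_upto_mixed] bounds the sum over all [k] and [l] by 2 K^2. *)
Definition wmixed (R : realType) (I : finType) d (c : expo I d -> R[i]) (A : {set I})
    (k l : nat) : R :=
  4 `^ (- (l%:R / k%:R)) * mixed predT c A k l / k%:R ^+ 10.

Lemma wmixed_ge0 (R : realType) (I : finType) d (c : expo I d -> R[i]) (A : {set I}) k l :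
  0 <= wmixed c A k l.
Proof. by rewrite divr_ge0 ?exprn_ge0// mulr_ge0 ?powR_ge0. Qed.

Lemma mixedE (R : realType) (I : finType) d (c : expo I d -> R[i]) (A : {set I}) k l :
  (0 < k)%N -> mixed predT c A k l = 4 `^ (l%:R / k%:R) * k%:R ^+ 10 * wmixed c A k l.
Proof.
move=> k0; rewrite /wmixed powRN.
have : 4 `^ (l%:R / k%:R) != 0 :> R by rewrite gt_eqF// powR_gt0.
have : k%:R != 0 :> R by rewrite pnatr_eq0 -lt0n.
by move=> kn pn; field; rewrite kn.
Qed.

(* The weights [4^(l/k)] and [4^(k/l)] recombine to [4], and a balanced split gains
   the factor [(k^(k/r) l^(l/r) / r)^10 <= (5/8)^10]. *)
Lemma balanced_product_le (R : realType) (X Y : R) k l :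
  (0 < k)%N -> (0 < l)%N -> balanced (k + l) k -> 0 <= X -> 0 <= Y ->
  (4 `^ (l%:R / k%:R) * k%:R ^+ 10 * X) `^ (k%:R / (k + l)%:R) *
  (4 `^ (k%:R / l%:R) * l%:R ^+ 10 * Y) `^ (l%:R / (k + l)%:R) <=
  4 * (5 / 8) ^+ 10 * (k + l)%:R ^+ 10 * (X + Y).
Proof.
move=> k0 l0 bal X0 Y0.
have kp : 0 < k%:R :> R by rewrite ltr0n.
have lp : 0 < l%:R :> R by rewrite ltr0n.
have [b1 b2] : k%:R + l%:R <= 4 * k%:R :> R /\ 4 * k%:R <= 3 * (k%:R + l%:R) :> R.
  by move: bal => /andP[]; rewrite -!natrD -!natrM !ler_nat.
rewrite natrD; set x : R := k%:R in kp b1 b2 *; set y : R := l%:R in lp b1 b2 *.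
pose t := x / (x + y).
have xy0 : 0 < x + y by lra.
have t01 : 0 < t <= 1 by rewrite divr_gt0//= ler_pdivrMr//; lra.
have -> : y / (x + y) = 1 - t by rewrite /t; field; lra.
have pM (a b z w : R) : 0 <= b -> 0 <= w ->
    (4 `^ a * b ^+ 10 * w) `^ z = 4 `^ (a * z) * (b `^ z) ^+ 10 * w `^ z.
  move=> b0 w0; have b10 : 0 <= b ^+ 10 by exact: exprn_ge0.
  rewrite (powRM _ (mulr_ge0 (powR_ge0 _ _) b10) w0) (powRM _ (powR_ge0 _ _) b10).
  rewrite powRrM -(powR_mulrn 10 b0) -(powR_mulrn 10 (powR_ge0 b z)).
  by rewrite [(b `^ _) `^ z]powRAC.
have kp' := ltW kp; have lp' := ltW lp; rewrite -/t !pM//.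
have -> : y / x * t = 1 - t by rewrite /t; field; lra.
have -> : x / y * (1 - t) = t by rewrite /t; field; lra.
have E4 : 4 `^ (1 - t) * 4 `^ t = 4 :> R.
  by rewrite -powRD ?pnatr_eq0 ?implybT// subrK powRr1.
rewrite [leLHS](_ : _ = (4 `^ (1 - t) * 4 `^ t) * (x `^ t * y `^ (1 - t)) ^+ 10 *
  (X `^ t * Y `^ (1 - t))); last by rewrite exprMn; ring.
rewrite E4.
(* For t in [1/4, 3/4], t^2 + (1-t)^2 <= 1/16 + 9/16 = 5/8. *)
have H1 : x `^ t * y `^ (1 - t) <= 5 / 8 * (x + y).
  apply: le_trans (powR_young (ltW kp) (ltW lp) t01) _.
  have -> : t * x + (1 - t) * y = (x ^+ 2 + y ^+ 2) / (x + y) by rewrite /t; field; lra.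
  rewrite ler_pdivrMr//; nra.
have H2 : X `^ t * Y `^ (1 - t) <= X + Y.
  apply: le_trans (powR_young X0 Y0 t01) _.
  move: t01 => /andP[t0 t1]; nra.
set u := x `^ t * _ in H1 *; set v := X `^ t * _ in H2 *.
have u0 : 0 <= u by rewrite mulr_ge0 ?powR_ge0.
have v0 : 0 <= v by rewrite mulr_ge0 ?powR_ge0.
clearbody u v.
have -> : 4 * (5 / 8) ^+ 10 * (x + y) ^+ 10 * (X + Y) = 4 * (5 / 8 * (x + y)) ^+ 10 * (X + Y).
  by rewrite exprMn; ring.
apply: ler_pM => //; first by rewrite mulr_ge0// exprn_ge0.
apply: ler_wpM2l => //; apply: lerXn2r => //; rewrite nnegrE; lra.
Qed.

Definition split_sum (R : realType) n d (c : expo 'I_n d -> R[i]) (A : {set 'I_n})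
    (B : pred (expo 'I_n d)) (r : nat) : R :=
  \sum_(a | (wt a == r) && B (restx A a)) cmod (c a) `^ bh_exp R r.

Lemma split_sumE (R : realType) n d (c : expo 'I_n d -> R[i]) (A : {set 'I_n})
    (B : pred (expo 'I_n d)) (r : nat) :
  split_sum c A B r = \sum_(k < r.+1)
    \sum_(b | [&& (wt b == k) && B b, onset A b & wt b == k])
      \sum_(g | onset (~: A) g && (wt g == (r - k)%N)) cmod (c (mergex A b g)) `^ bh_exp R r.
Proof. exact: sum_restx. Qed.

Lemma balanced_bounds r k : (0 < r)%N -> balanced r k -> (0 < k < r)%N.
Proof. by rewrite /balanced; lia. Qed.

Lemma balancedB r k : (k <= r)%N -> balanced r (r - k) = balanced r k.
Proof. by rewrite /balanced => kr; apply/idP/idP; lia. Qed.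

(** Blei's inequality is applied for each [k] separately. Raising the sum over [k] to the power 1 +
    1/r costs the number of its terms only to the power 1/r. *)
Lemma split_balanced_le (R : realType) n d (c : expo 'I_n d -> R[i]) (A : {set 'I_n}) r :
  (0 < r)%N ->
  split_sum c A (fun b => balanced r (wt b)) r `^ (1 + r%:R^-1) <=
  r%:R `^ r%:R^-1 * (4 * (5 / 8) ^+ 10 * r%:R ^+ 10) *
  \sum_(k < r.+1 | balanced r k) (wmixed c A k (r - k) + wmixed c (~: A) k (r - k)).
Proof.
move=> r0; set s := 1 + r%:R^-1.
have s0 : 0 < s := inv1_gt0 R r.
have s1 : 1 <= s := inv1_ge1 R r.
set C := 4 * (5 / 8) ^+ 10 * r%:R ^+ 10.
have C0 : 0 <= C by rewrite !mulr_ge0// ?exprn_ge0//; lra.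
pose M (k : nat) : R := C * (wmixed c A k (r - k) + wmixed c (~: A) (r - k) k).
have M0 k : 0 <= M k by rewrite mulr_ge0// addr_ge0// wmixed_ge0.
have le1 : split_sum c A (fun b => balanced r (wt b)) r <=
    \sum_(k < r.+1 | balanced r k) M k `^ s^-1.
  rewrite split_sumE; rewrite [leRHS]big_mkcond/=.
  apply: ler_sum => k _; case: ifPn => [bk|bk]; last first.
    by rewrite big_pred0// => b; case: eqP => //= ->; rewrite (negPf bk).
  have /andP[k0 kr] := balanced_bounds r0 bk.
  have l0 : (0 < r - k)%N by rewrite subn_gt0.
  have klr : (k + (r - k) = r)%N by rewrite subnKC// ltnW.
  apply: le_trans (_ : _ <= \sum_(b | [&& predT b, onset A b & wt b == k])
    \sum_(g | onset (~: A) g && (wt g == (r - k)%N))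
       cmod (c (mergex A b g)) `^ bh_exp R (k + (r - k))) _.
    rewrite klr big_mkcond [leRHS]big_mkcond/=; apply: ler_sum => b _.
    case: eqP => //= [->|_]; last by rewrite andbF.
    by rewrite bk.
  apply: le_trans (mixed_blei predT c A k0 l0) _; rewrite klr.
  apply: ge0_ler_powR.
  - by rewrite invr_ge0 ltW.
  - by rewrite nnegrE mulr_ge0 ?powR_ge0.
  - by rewrite nnegrE M0.
  rewrite (mixedE c A _ k0) (mixedE c (~: A) _ l0).
  have := @balanced_product_le R (wmixed c A k (r - k)) (wmixed c (~: A) (r - k) k) k (r - k) k0 l0.
  by rewrite klr => /(_ bk (wmixed_ge0 _ _ _ _) (wmixed_ge0 _ _ _ _)).
apply: (@le_trans _ _ ((\sum_(k < r.+1 | balanced r k) M k `^ s^-1) `^ s)).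
  apply: ge0_ler_powR le1.
  - exact: ltW.
  - by rewrite nnegrE; apply: sumr_ge0 => a _; exact: powR_ge0.
  - by rewrite nnegrE; apply: sumr_ge0 => a _; exact: powR_ge0.
have T0 (k : 'I_r.+1) : 0 <= M k `^ s^-1 by exact: powR_ge0.
apply: le_trans (powR_sum_le _ s1 T0) _.
have -> : s - 1 = r%:R^-1 by rewrite /s addrC addKr.
rewrite -mulrA; apply: ler_pM; rewrite ?powR_ge0//.
- by apply: sumr_ge0 => k _; exact: powR_ge0.
(* At most [r] of the [r.+1] indices are balanced, because [k = r] is not. *)
- apply: ge0_ler_powR; rewrite ?invr_ge0 ?nnegrE// ler_nat.
  rewrite -[leqRHS](card_ord r) -(card_ord r) -ltnS.
  rewrite [ltnRHS](_ : _ = #|'I_r.+1|) ?card_ord//.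
  rewrite -[ltnRHS](card_ord r.+1); apply: proper_card; apply/properP; split.
    by apply/fintype.subsetP.
  exists ord_max => //; rewrite unfold_in/=.
  by apply/negP => /(balanced_bounds r0); rewrite ltnn andbF.
under eq_bigr do rewrite -powRrM mulVf ?gt_eqF// powRr1//.
rewrite /M -mulr_sumr; apply: ler_wpM2l => //.
rewrite !big_split/= lerD2l le_eqVlt; apply/orP; left; apply/eqP.
(* Balance is symmetric under k -> r - k, which puts the terms of the complement in the same
   form. *)
rewrite (reindex_inj rev_ord_inj)/=; apply: eq_big => [k|k _].
  by rewrite subSS balancedB// -ltnS.
by rewrite subSS subKn// -ltnS.
Qed.

Lemma mixed_le_bh_upto (R : realType) (K : R) N n d (c : expo 'I_n d -> R[i])
    (A : {set 'I_n}) k l :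
  bh_upto K N -> unitbd c -> (0 < k <= N)%N ->
  mixed predT c A k l <= 2 * 4 `^ (l%:R / k%:R) * k%:R ^+ 10 * K ^+ 2.
Proof.
move=> SN c1 /andP[k0 kN].
have H : wmixed c A k l <= 2 * K ^+ 2.
  apply: le_trans (bh_upto_mixed A l.+1 SN c1); rewrite big_nat_ord1.
  have kk : (k.-1 < N)%N by rewrite prednK.
  rewrite (bigD1 (Ordinal kk))//= prednK// (bigD1 (Ordinal (ltnSn l)))//=.
  rewrite -addrA lerDl addr_ge0// sumr_ge0// => i _; first exact: wmixed_ge0.
  by apply: sumr_ge0 => j _; exact: wmixed_ge0.
rewrite mixedE//.
have x0 : 0 <= k%:R ^+ 10 :> R by exact: exprn_ge0.
have p0 : 0 <= 4 `^ (l%:R / k%:R) :> R by exact: powR_ge0.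
move: (_ ^+ 10) (4 `^ _) x0 p0 => x p x0 p0.
have -> : 2 * p * x * K ^+ 2 = p * x * (2 * K ^+ 2) by ring.
by apply: ler_wpM2l => //; exact: mulr_ge0.
Qed.

(** The powers of 2 and 4 recombine to 2 and 4, giving 8. Since y/(x+y) <= 1/2, the remaining factor
    y^10 K^2 contributes at most its square root; this is where the exponent of [K] drops from 2 to
    1. *)
Lemma skew_product_le (R : realType) (K x y : R) :
  1 <= K -> 1 <= y -> y <= x ->
  (2 * 4 `^ (y / x)) `^ (x / (x + y)) *
  (2 * 4 `^ (x / y) * y ^+ 10 * K ^+ 2) `^ (y / (x + y)) <= 8 * K * (x + y) ^+ 5.
Proof.
move=> K1 y1 yx.
have lp : 0 < y by apply: lt_le_trans y1.
have kp : 0 < x by apply: lt_le_trans yx.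
have rp : 0 < x + y by rewrite addr_gt0.
have K0 : 0 <= K by apply: le_trans K1.
have W0 : 0 <= y ^+ 10 * K ^+ 2 by apply: mulr_ge0; [exact: exprn_ge0 (ltW lp) | exact: exprn_ge0].
rewrite -(mulrA (2 * 4 `^ (x / y))).
rewrite (powRM _ (mulr_ge0 _ (powR_ge0 _ _)) W0)//.
rewrite !(powRM _ _ (powR_ge0 _ _))//.
rewrite -!powRrM.
have -> : y / x * (x / (x + y)) = y / (x + y) by rewrite mulrA divfK// gt_eqF.
have -> : x / y * (y / (x + y)) = x / (x + y) by rewrite mulrA divfK// gt_eqF.
have xyr : x / (x + y) + y / (x + y) = 1 by rewrite -mulrDl mulfV// gt_eqF.
have E2 a : 0 < a -> a `^ (x / (x + y)) * a `^ (y / (x + y)) = a.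
  by move=> a0; rewrite -powRD ?(gt_eqF a0) ?implybT// xyr powRr1// ltW.
have H1 : (y ^+ 10 * K ^+ 2) `^ (y / (x + y)) <= K * (x + y) ^+ 5.
  have yh : y / (x + y) <= 2^-1 by rewrite ler_pdivrMr//; lra.
  have W1 : 1 <= y ^+ 10 * K ^+ 2 by rewrite -[leLHS]mulr1 ler_pM// exprn_ege1.
  apply: le_trans (ler_powR W1 yh) _.
  rewrite powR12_sqrt// (_ : y ^+ 10 * K ^+ 2 = (y ^+ 5 * K) ^+ 2); last first.
    by rewrite exprMn -exprM.
  rewrite sqrtr_sqr ger0_norm; last by apply: mulr_ge0 => //; exact: exprn_ge0 (ltW lp).
  rewrite mulrC.
  by apply: ler_wpM2l => //; apply: lerXn2r; rewrite ?nnegrE; lra.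
rewrite [leLHS](_ : _ = (2 `^ (x / (x + y)) * 2 `^ (y / (x + y))) *
  (4 `^ (x / (x + y)) * 4 `^ (y / (x + y))) * (y ^+ 10 * K ^+ 2) `^ (y / (x + y))); last by ring.
rewrite !E2//.
have -> : 8 * K * (x + y) ^+ 5 = 2 * 4 * (K * (x + y) ^+ 5) by ring.
by apply: ler_wpM2l => //; lra.
Qed.

(** In Blei's inequality the factor of the pure power is bounded by [mixed_diag_le] and the other
    one by the induction statement in degree r - k, which is at most [N]. The count [r.+1] is that
    of the possible [k]. *)
Lemma split_pointed_le (R : realType) (K : R) N n d (c : expo 'I_n d -> R[i])
    (A : {set 'I_n}) r :
  1 <= K -> bh_upto K N -> unitbd c -> (0 < r <= N.+1)%N ->
  split_sum c A (pointed r) r <= r.+1%:R * (8 * K * r%:R ^+ 5) `^ (1 + r%:R^-1)^-1.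
Proof.
move=> K1 SN c1 /andP[r0 rN]; rewrite split_sumE.
set s := 1 + r%:R^-1.
have s0 : 0 < s := inv1_gt0 R r.
have K0 : 0 <= K by apply: le_trans K1.
have r1 : 1 <= r%:R :> R by rewrite ler1n.
have r5 : 1 <= r%:R ^+ 5 :> R by rewrite exprn_ege1.
have B0 : 0 <= 8 * K * r%:R ^+ 5 by apply: mulr_ge0; [exact: mulr_ge0 | exact: exprn_ge0].
have B8 : 8 <= 8 * K * r%:R ^+ 5.
  by rewrite -mulrA ler_peMr// -[leLHS]mulr1 ler_pM.
rewrite [leRHS](_ : _ = \sum_(k < r.+1) (8 * K * r%:R ^+ 5) `^ s^-1); last first.
  by rewrite sumr_const card_ord mulr_natl.
apply: ler_sum => k _.
have [rk|rk] := leqP (2 * k) r.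
  rewrite big_pred0 ?powR_ge0// => b; case: eqP => //= bk.
  by rewrite /pointed bk ltnNge rk andbF.
have k0 : (0 < k)%N by lia.
have kr : (k <= r)%N by rewrite -ltnS.
pose P := @diag 'I_n d k.
apply: (@le_trans _ _ (\sum_(b | [&& P b, onset A b & wt b == k])
  \sum_(g | onset (~: A) g && (wt g == (r - k)%N))
     cmod (c (mergex A b g)) `^ bh_exp R r)).
  rewrite big_mkcond [leRHS]big_mkcond/=; apply: ler_sum => b _.
  case: eqP => //= [bk|_]; last by rewrite !andbF.
  by rewrite /pointed bk rk /P !andbT.
(* For [k = r] the monomial is a pure power and Blei's inequality, which needs both degrees
   positive, is replaced by the diagonal bound alone. *)
have [kE|kn] := eqVneq (k : nat) r.
  have -> : (r - k = 0)%N by rewrite kE subnn.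
  have HH := mixed_diag_le A 0 c1 k0.
  move: HH; rewrite mul0r powRr0 mulr1 kE -/s => HH.
  apply: (@le_trans _ _ (mixed (diag r) c A r 0 `^ s^-1)); last first.
    apply: ge0_ler_powR.
    - by rewrite invr_ge0 ltW.
    - by rewrite nnegrE mixed_ge0.
    - by rewrite nnegrE.
    by apply: le_trans HH _; lra.
  rewrite /mixed -/s -powRrM mulfV ?gt_eqF// powRr1; last first.
    by apply: sumr_ge0 => b _; exact: powR_ge0.
  rewrite /P kE; apply: ler_sum => b _.
  pose g0 : expo 'I_n d := [ffun=> ord0].
  have g0P g : onset (~: A) g && (wt g == 0)%N = (g == g0).
    apply/idP/eqP => [/andP[_]|->].
      rewrite /wt sum_nat_eq0 => /forallP gz; apply/ffunP => i; rewrite ffunE.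
      by apply/val_inj/eqP; exact: gz.
    apply/andP; split; first by apply/forallP => i; rewrite ffunE eqxx implybT.
    by rewrite /wt sum_nat_eq0; apply/forallP => i; rewrite ffunE.
  rewrite !(eq_bigl _ _ g0P) !big_pred1_eq -powR_mulrn ?cmod_ge0// -powRrM.
  by rewrite -(bh_expM R r0) -/s mulfK// gt_eqF.
have {}kr : (k < r)%N by rewrite ltn_neqAle kn.
have l0 : (0 < r - k)%N by rewrite subn_gt0.
have klr : (k + (r - k) = r)%N by rewrite subnKC// ltnW.
have := mixed_blei P c A k0 l0; rewrite klr => H; apply: le_trans H _.
apply: ge0_ler_powR.
- by rewrite invr_ge0 ltW.
- by rewrite nnegrE mulr_ge0 ?powR_ge0.
- by rewrite nnegrE.
have lN : (0 < r - k <= N)%N by rewrite l0; lia.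
have U := mixed_diag_le A (r - k) c1 k0.
have V := mixed_le_bh_upto (~: A) k SN c1 lN.
set l := (r - k)%N in l0 klr lN U V *.
have kp : 0 < (k : nat)%:R :> R by rewrite ltr0n.
have lp : 0 < l%:R :> R by rewrite ltr0n.
have rE : r%:R = (k : nat)%:R + l%:R :> R by rewrite -natrD klr.
set x : R := (k : nat)%:R in kp rE U V *; set y : R := l%:R in lp rE U V *.
have yx : y <= x.
  by rewrite ler_nat; lia.
have rp : 0 < r%:R :> R by rewrite ltr0n.
have tp : 0 <= x / r%:R by rewrite divr_ge0// ltW.
have up : 0 <= y / r%:R by rewrite divr_ge0// ltW.
apply: (@le_trans _ _ ((2 * 4 `^ (y / x)) `^ (x / r%:R) *
    (2 * 4 `^ (x / y) * y ^+ 10 * K ^+ 2) `^ (y / r%:R))).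
  apply: ler_pM; rewrite ?powR_ge0//.
    by apply: ge0_ler_powR U; rewrite ?nnegrE ?mixed_ge0.
  apply: ge0_ler_powR V; rewrite ?nnegrE ?mixed_ge0//.
  apply: mulr_ge0; last exact: exprn_ge0.
  apply: mulr_ge0; last exact: exprn_ge0 (ltW lp).
  by rewrite mulr_ge0 ?powR_ge0.
by rewrite rE; apply: skew_product_le => //; rewrite ler1n.
Qed.

(** * Numerical constants and closing of the recursion *)

Lemma powRD_le (R : realType) (x y s : R) : 1 <= s -> 0 <= x -> 0 <= y ->
  (x + y) `^ s <= 2 `^ (s - 1) * (x `^ s + y `^ s).
Proof.
move=> s1 x0 y0; have := @powR_sum_le R bool predT (fun b => if b then x else y) s s1.
by rewrite !big_bool card_bool; apply; case.
Qed.

(** These bound the r-th roots of 4r and 12 r^2 by 3 and 7; at r = 2 they read 8 <= 9 and 48 <=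
    49. *)
Lemma exp_bounds r : (2 <= r)%N -> (4 * r <= 3 ^ r)%N /\ (12 * r ^ 2 <= 7 ^ r)%N.
Proof.
case: r => [|[|r]] // _; elim: r => // r [].
rewrite -!mulnn (expnS 3 r.+2) (expnS 7 r.+2).
by move: (3 ^ _)%N (7 ^ _)%N => u v H1 H2; split; nia.
Qed.

(** Here 24 = 2 * 4 * 3: the inverse probability of balance, the constant of [balanced_product_le],
    and the bound for (4r)^(1/r). Likewise 336 = 7 * 6 * 8: the bound for (12 r^2)^(1/r), the
    estimate 4 r (r+1) <= 6 r^2 for inverse probability times number of [k], and the constant of
    [skew_product_le]. *)
Lemma bh_norm2_le (R : realType) (K : R) N n d (c : expo 'I_n d -> R[i]) r :
  1 <= K -> bh_upto K N -> unitbd c -> (2 <= r <= N.+1)%N ->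
  bh_norm2 r c <= 24 * (5 / 8) ^+ 10 * r%:R ^+ 10 * avg (fun A : {set 'I_n} =>
      \sum_(k < r.+1 | balanced r k) (wmixed c A k (r - k) + wmixed c (~: A) k (r - k))) +
    336 * K * r%:R ^+ 7.
Proof.
move=> K1 SN c1 /andP[r2 rN]; have r0 : (0 < r)%N by lia.
have [e4 e12] := exp_bounds r2.
have K0 : 0 <= K by apply: le_trans K1.
pose s : R := 1 + r%:R^-1.
have s0 : 0 < s := inv1_gt0 R r.
have s1 : 1 <= s := inv1_ge1 R r.
have sE : s - 1 = r%:R^-1 by rewrite /s addrC addKr.
pose x (a : expo 'I_n d) := cmod (c a) `^ bh_exp R r.
have x0 a : 0 <= x a by exact: powR_ge0.
set S := avg (fun A : {set 'I_n} => _).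
have S0 : 0 <= S.
  by apply: avg_ge0 => A; apply: sumr_ge0 => k _; rewrite addr_ge0// wmixed_ge0.
pose ND := \sum_(a | (wt a == r) && ~~ dominated a) x a.
pose D := \sum_(a | (wt a == r) && dominated a) x a.
have ND0 : 0 <= ND by exact: sumr_ge0.
have D0 : 0 <= D by exact: sumr_ge0.
have rp : 0 < r%:R :> R by rewrite ltr0n.
have NDle : ND <= 2 * avg (fun A : {set 'I_n} => split_sum c A (fun b => balanced r (wt b)) r).
  rewrite -[2 in leRHS]invrK; apply: sum_le_avg => // [u /andP[]//|a /andP[/eqP ar nd]].
  have := @card_balanced n d a; rewrite ar => /(_ r0) H.
  rewrite /avg card_sets card_ord ler_pdivlMl ?ltr0n ?expn_gt0//.
  rewrite ler_pdivrMr// -natr_sum -natrM ler_nat mulnC; apply: H => i.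
  by move: nd => /existsPn/(_ i); rewrite ar -leqNgt.
have sr : ((2 * r).-1.+1 = 2 * r)%N by rewrite prednK// muln_gt0.
have Dle : D <= (4 * r)%:R * avg (fun w : {ffun 'I_n -> 'I_(2 * r).-1.+1} =>
    split_sum c (colset w) (pointed r) r).
  rewrite -[(4 * r)%:R]invrK; apply: sum_le_avg => // [|u /andP[]//|a /andP[/eqP ar ad]].
    by rewrite invr_gt0 ltr0n muln_gt0.
  by have := @avg_pointed R n d (2 * r).-1 a ad; rewrite ar; apply.
pose B := 8 * K * r%:R ^+ 5.
have B0 : 0 <= B by apply: mulr_ge0; [exact: mulr_ge0 | exact: exprn_ge0].
have Dle2 : D <= (4 * r)%:R * (r.+1%:R * B `^ s^-1).
  apply: le_trans Dle _; apply: ler_wpM2l => //.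
  apply: avg_le => [|w]; first by rewrite mulr_ge0 ?powR_ge0.
  by apply: split_pointed_le SN c1 _ => //; rewrite r0.
have -> : bh_norm2 r c = (ND + D) `^ s.
  rewrite /bh_norm2 -/s; congr (_ `^ _).
  by rewrite (bigID (@dominated n d))/= addrC.
apply: le_trans (powRD_le s1 ND0 D0) _; rewrite sE mulrDr; apply: lerD.
  have H : ND `^ s <= 2 `^ s * (r%:R `^ r%:R^-1 * (4 * (5 / 8) ^+ 10 * r%:R ^+ 10) * S).
    set T := avg _ in NDle.
    have T0 : 0 <= T by apply: avg_ge0 => A; apply: sumr_ge0 => a _; exact: powR_ge0.
    apply: (@le_trans _ _ ((2 * T) `^ s)).
      by apply: ge0_ler_powR NDle; rewrite ?(ltW s0) ?nnegrE ?(mulr_ge0 (ler0n _ 2) T0).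
    rewrite powRM//; apply: ler_wpM2l; first exact: powR_ge0.
    apply: le_trans (jensen_avg s1 _) _ => [A|].
      by apply: sumr_ge0 => a _; exact: powR_ge0.
    by rewrite /S -avgZ; apply: ler_avg => A; exact: split_balanced_le.
  apply: le_trans (ler_wpM2l (powR_ge0 _ _) H) _.
  have -> : 2 `^ s = 2 * 2 `^ r%:R^-1 :> R.
    by rewrite /s powRD ?pnatr_eq0 ?implybT// powRr1.
  have E4 : 2 `^ r%:R^-1 * 2 `^ r%:R^-1 * r%:R `^ r%:R^-1 <= 3 :> R.
    rewrite -!powRM// -natrM; apply: powR_inv_le => //.
    by rewrite -natrM -natrX ler_nat; exact: e4.
  set u := 2 `^ _ in E4 *; set v := r%:R `^ r%:R^-1 in E4 *.
  have Z0 : 0 <= 8 * (5 / 8) ^+ 10 * r%:R ^+ 10 * S.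
    by apply: mulr_ge0.
  move: (_ ^+ 10) (r%:R ^+ 10) Z0 => h w Z0.
  rewrite [leLHS](_ : _ = u * u * v * (8 * h * w * S)); last by ring.
  rewrite [leRHS](_ : _ = 3 * (8 * h * w * S)); last by ring.
  exact: ler_wpM2r.
have H : D `^ s <= (4 * r * r.+1)%:R * (4 * r * r.+1)%:R `^ r%:R^-1 * B.
  rewrite mulrA -natrM in Dle2.
  have W0 : 0 <= (4 * r * r.+1)%:R * B `^ s^-1 by rewrite mulr_ge0 ?powR_ge0.
  apply: (@le_trans _ _ (((4 * r * r.+1)%:R * B `^ s^-1) `^ s)).
    by apply: ge0_ler_powR Dle2; rewrite ?(ltW s0) ?nnegrE.
  rewrite (powRM _ _ (powR_ge0 _ _))// -powRrM mulVf ?gt_eqF// powRr1//.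
  by rewrite /s powRD ?powRr1// pnatr_eq0 !muln_eq0/= (gtn_eqF r0) implybT.
apply: le_trans (ler_wpM2l (powR_ge0 _ _) H) _.
have E7 : 2 `^ r%:R^-1 * (4 * r * r.+1)%:R `^ r%:R^-1 <= 7 :> R.
  rewrite -powRM// -natrM; apply: powR_inv_le => //.
  by rewrite -natrX ler_nat; apply: leq_trans e12; rewrite -mulnn; clear -r2; nia.
have E6 : (4 * r * r.+1)%:R <= 6 * r%:R ^+ 2 :> R.
  by rewrite -natrX -natrM ler_nat -mulnn; clear -r2; nia.
rewrite [leLHS](_ : _ = (2 `^ r%:R^-1 * (4 * r * r.+1)%:R `^ r%:R^-1) *
  ((4 * r * r.+1)%:R * B)); last by ring.
have -> : 336 * K * r%:R ^+ 7 = 7 * (6 * r%:R ^+ 2 * B).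
  by rewrite /B -[7%N]/(2 + 5)%N exprD; ring.
apply: ler_pM => //.
- by rewrite mulr_ge0 ?powR_ge0.
- exact: ler_wpM2r.
Qed.

(** Each pair (k, l) lies on one antidiagonal k + l = r only. Balance excludes k = 0 and k = r, so r
    <= N + 1 forces 1 <= k <= N, the range of the induction statement. *)
Lemma sum_antidiagonal_le (R : realType) (G : nat -> nat -> R) N :
  (forall k l, 0 <= G k l) ->
  \sum_(i < N) \sum_(k < i.+3 | balanced i.+2 k) G k (i.+2 - k)%N <=
  \sum_(1 <= k < N.+1) \sum_(l < N.+1) G k l.
Proof.
move=> G0; rewrite big_nat_ord1.
pose H (i : 'I_N) (k : 'I_N) (l : 'I_N.+1) : R := if (k.+1 + l == i.+2)%N then G k.+1 l else 0.
have H0 i k l : 0 <= H i k l by rewrite /H; case: ifP.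
apply: (@le_trans _ _ (\sum_(i < N) \sum_(k < N) \sum_(l < N.+1) H i k l)).
  apply: ler_sum => i _.
  have b0 : balanced i.+2 (@ord0 i.+2) = false.
    by apply/negP => /balanced_bounds -/(_ isT).
  have bm : balanced i.+2 (lift ord0 (@ord_max i.+1)) = false.
    by apply/negP => /balanced_bounds -/(_ isT) /andP[_]; rewrite lift0 ltnn.
  rewrite big_mkcond big_ord_recl b0 [leLHS]add0r big_ord_recr bm.
  rewrite [leLHS]addr0 (big_ord_widen N (fun k => if balanced i.+2 (bump 0 k)
    then G (bump 0 k) (i.+2 - bump 0 k)%N else 0)) ?ltn_ord// big_mkcond/=.
  apply: ler_sum => k _; case: ifP => [ki|_]; last exact: sumr_ge0.
  case: ifP => [_|_]; last exact: sumr_ge0.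
  have lN : (i.+2 - k.+1 < N.+1)%N by have := ltn_ord i; lia.
  rewrite (bigD1 (Ordinal lN))//= {1}/H /= subnKC; last by rewrite ltnS ltnW.
  by rewrite eqxx lerDl sumr_ge0.
rewrite exchange_big/=; apply: ler_sum => k _.
rewrite exchange_big/=; apply: ler_sum => l _.
have [il|il] := boolP [exists i : 'I_N, k.+1 + l == i.+2]%N.
  have /existsP[i ie] := il.
  rewrite (bigD1 i)//= /H ie big1 ?addr0// => j ji.
  by rewrite ifN//; apply: contra ji => /eqP e; apply/eqP/val_inj; move: ie; rewrite e => /eqP[].
rewrite big1// => i _; rewrite /H ifN//.
by move: il => /existsPn; apply.
Qed.

(** Telescoping, from (x+1)^-3 <= x^-1 - (x+1)^-1. The cube is what remains of r^7 after division by
    the weight r^10. *)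
Lemma sum_inv_cube_le (R : realType) N :
  \sum_(i < N) (i.+2%:R ^+ 3)^-1 <= 1 - N.+1%:R^-1 :> R.
Proof.
elim: N => [|N IH]; first by rewrite big_ord0 invr1 subrr.
rewrite big_ord_recr/=; apply: le_trans (lerD IH (lexx _)) _.
have p : 0 < N.+1%:R :> R by rewrite ltr0n.
rewrite -[N.+2%:R]natr1; move: (N.+1%:R) p => x p.
have -> : 1 - x^-1 + (x + 1) ^- 3 = 1 - (x + 1)^-1 - ((x * (x + 1))^-1 - (x + 1) ^- 3).
  by field; lra.
rewrite gerBl subr_ge0 lef_pV2 ?posrE ?exprn_gt0 ?mulr_gt0 ?addr_gt0//.
by nra.
Qed.

(** q_1 = 1 and every monomial of degree 1 is diagonal, so the l^1 bound applies directly. *)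
Lemma bh_norm2_1 (R : realType) n d (c : expo 'I_n d -> R[i]) : unitbd c -> bh_norm2 1 c <= 1.
Proof.
move=> c1; rewrite /bh_norm2.
have -> : bh_exp R 1 = 1 by rewrite /bh_exp muln1 divff.
have H : \sum_(g : expo 'I_n d | wt g == 1%N) cmod (c g) `^ 1 <= 1.
  apply: le_trans (diag_coef_sum_le c1 (ltnSn 0)).
  rewrite (eq_bigl (fun g : expo 'I_n d => (wt g == 1%N) && diag 1 g)); last first.
    move=> g; case: eqP => //= g1; apply/esym.
    by rewrite diag_modn//; apply/forallP => i; rewrite !modn1.
  by apply: ler_sum => g _; rewrite powRr1 ?cmod_ge0.
rewrite [leRHS](_ : 1 = 1 `^ (1 + 1%:R^-1)); last by rewrite powR1.
apply: ge0_ler_powR H; first by rewrite addr_ge0.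
- by rewrite nnegrE sumr_ge0// => g _; exact: powR_ge0.
- by rewrite nnegrE.
Qed.

(** The 1 is the degree 1, and 96 = 24 * 4, where 4 K^2 collects 2 K^2 from [A] and 2 K^2 from its
    complement. The same [K] comes out, so the induction loses nothing from one degree to the
    next. *)
Lemma bh_upto_step (R : realType) (K : R) N :
  1 <= K -> 1 + 96 * (5 / 8) ^+ 10 * K ^+ 2 + 336 * K <= K ^+ 2 ->
  bh_upto K N -> bh_upto K N.+1.
Proof.
move=> K1 Kclose SN n d c c1.
rewrite big_nat_ord1 big_ord_recl/=.
pose T i (A : {set 'I_n}) := \sum_(k < i.+3 | balanced i.+2 k)
  (wmixed c A k (i.+2 - k) + wmixed c (~: A) k (i.+2 - k)).
have step (i : 'I_N) : bh_norm2 (bump 0 i).+1 c / (bump 0 i).+1%:R ^+ 10 <=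
    24 * (5 / 8) ^+ 10 * avg (T i) + 336 * K * (i.+2%:R ^+ 3)^-1.
  have p : 0 < i.+2%:R :> R by rewrite ltr0n.
  rewrite /bump/= add1n ler_pdivrMr ?exprn_gt0//.
  apply: le_trans (bh_norm2_le K1 SN c1 (_ : 2 <= i.+2 <= N.+1)%N) _; first by rewrite /= ltnS.
  rewrite -/(T i); move: (avg _) (i.+2%:R) p => a x p.
  rewrite le_eqVlt; apply/orP; left; apply/eqP.
  by move: (_ ^+ 10) => h; field; lra.
have avgT : \sum_(i < N) avg (T i) <= 4 * K ^+ 2.
  rewrite -avg_sum; apply: avg_le => [|A]; first by rewrite mulr_ge0// sqr_ge0.
  have half B : \sum_(i < N) \sum_(k < i.+3 | balanced i.+2 k) wmixed c B k (i.+2 - k) <=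
      2 * K ^+ 2.
    apply: le_trans (sum_antidiagonal_le N (fun k l => wmixed_ge0 c B k l)) _.
    exact: bh_upto_mixed.
  rewrite /T; under eq_bigr do rewrite big_split/=.
  rewrite big_split/=; apply: le_trans (lerD (half A) (half (~: A))) _; lra.
have cubes := sum_inv_cube_le R N.
have cubes1 : \sum_(i < N) (i.+2%:R ^+ 3)^-1 <= 1 :> R.
  by apply: le_trans cubes _; rewrite gerBl invr_ge0.
have first_le : bh_norm2 1 c / 1%:R ^+ 10 <= 1.
  by rewrite expr1n divr1 bh_norm2_1.
apply: le_trans (lerD first_le (ler_sum _ (fun i _ => step i))) _.
rewrite big_split/= -[X in _ + (X + _)]mulr_sumr -[X in _ + (_ + X)]mulr_sumr.
move: (\sum_(i < N) avg (T i)) (\sum_(i < N) (_ ^+ 3)^-1) avgT cubes1 => a b ha hb.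
have h0 : 0 <= 24 * (5 / 8) ^+ 10 :> R by rewrite mulr_ge0// exprn_ge0.
apply: le_trans Kclose; rewrite -addrA lerD2l; apply: lerD.
  apply: le_trans (ler_wpM2l h0 ha) _.
  by rewrite le_eqVlt; apply/orP; left; apply/eqP; ring.
have K336 : 0 <= 336 * K by apply: mulr_ge0 => //; exact: le_trans K1.
by rewrite -[leRHS]mulr1; exact: ler_wpM2l.
Qed.

Lemma bh_upto_4000 (R : realType) N : bh_upto (4000 : R) N.
Proof.
elim: N => [|N IH]; first by move=> n d c c1; rewrite big_nat_ord1 big_ord0 sqr_ge0.
apply: bh_upto_step IH; first by rewrite ler1n.
(* 96 * 0.0091 = 0.8736 leaves more than 0.12 K^2 for 336 K + 1, which 4000 satisfies with room to
   spare. *)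
have : (5 / 8) ^+ 10 <= 91 / 10000 :> R by lra.
by move: (_ ^+ 10) => h hh; lra.
Qed.

(** * Transfer to [mpoly] *)

Definition multinom_of_expo n d (g : expo 'I_n d) : multinom n :=
  @Multinom n [tuple (g i : nat) | i < n].

Lemma multinom_of_expoE n d (g : expo 'I_n d) i : fun_of_multinom (multinom_of_expo g) i = g i.
Proof. by rewrite /fun_of_multinom tnth_mktuple. Qed.

Lemma multinom_of_expo_inj n d : injective (@multinom_of_expo n d).
Proof.
move=> g h gh; apply/ffunP => i; apply/val_inj.
by rewrite /= -(multinom_of_expoE g) gh multinom_of_expoE.
Qed.

Lemma mdeg_multinom_of_expo n d (g : expo 'I_n d) : mdeg (multinom_of_expo g) = wt g.
Proof. by rewrite mdegE; apply: eq_bigr => i _; rewrite multinom_of_expoE. Qed.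

Lemma sum_msupp (A : nzRingType) (V : nmodType) n d (p : mpoly n A) (f : multinom n -> V) :
  (forall m, m \notin msupp p -> f m = 0) -> {in msupp p, forall m, (mdeg m <= d)%N} ->
  \sum_(m <- msupp p) f m = \sum_(g : expo 'I_n d) f (multinom_of_expo g).
Proof.
move=> f0 pd; pose e := @multinom_of_expo n d.
rewrite [RHS](bigID (fun g => e g \in msupp p))/= [X in _ + X]big1 ?addr0; last first.
  by move=> g; exact: f0.
rewrite -[RHS]big_filter; set G := [seq g <- index_enum _ | _].
have -> : \sum_(g <- G) f (multinom_of_expo g) = \sum_(m <- [seq e g | g <- G]) f m.
  by rewrite big_map.
apply: perm_big; apply: uniq_perm.
- exact: msupp_uniq.
- rewrite map_inj_uniq; last exact: multinom_of_expo_inj.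
  by rewrite filter_uniq// index_enum_uniq.
move=> m; apply/idP/mapP => [mp|[g]]; last by rewrite mem_filter => /andP[gp _] ->.
have md i : (fun_of_multinom m i < d.+1)%N.
  by rewrite ltnS (leq_trans _ (pd _ mp))// mdegE (bigD1 i)//= leq_addr.
pose g : expo 'I_n d := [ffun i => inord (fun_of_multinom m i)].
have eg : e g = m.
  by apply/mnmP => i; rewrite /e multinom_of_expoE ffunE inordK.
by exists g => //; rewrite mem_filter eg mp mem_index_enum.
Qed.

Lemma peval_meval (R : realType) n d (p : mpoly n R[i]) (z : 'I_n -> R[i]) :
  {in msupp p, forall m, (mdeg m <= d)%N} ->
  meval z p = peval (fun g : expo 'I_n d => mcoeff (multinom_of_expo g) p) z.
Proof.
move=> pd; rewrite mevalE (sum_msupp (d := d))//; last first.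
  by move=> m /memN_msupp_eq0 ->; rewrite mul0r.
by apply: eq_bigr => g _; congr (_ * _); apply: eq_bigr => i _; rewrite multinom_of_expoE.
Qed.

Lemma cmod_mono_le1 (R : realType) (I : finType) d (z : I -> R[i]) (g : expo I d) :
  (forall i, cmod (z i) <= 1) -> cmod (mono z g) <= 1.
Proof.
move=> z1; rewrite cmod_prod; apply: prodr_ile1 => i _.
by rewrite cmodX exprn_ge0 ?cmod_ge0//= exprn_ile1 ?cmod_ge0.
Qed.

Lemma cmod_peval_le_sum (R : realType) (I : finType) d (c : expo I d -> R[i]) (z : I -> R[i]) :
  (forall i, cmod (z i) <= 1) -> cmod (peval c z) <= \sum_g cmod (c g).
Proof.
move=> z1; apply: le_trans (cmod_sum _ _) _; apply: ler_sum => g _.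
by rewrite Normc.normcM ler_piMr ?cmod_ge0 ?cmod_mono_le1.
Qed.

Lemma cmod_real (R : realType) (t : R) : 0 <= t -> cmod (t%:C%C) = t.
Proof. by move=> t0; rewrite /= expr0n/= addr0 sqrtr_sqr ger0_norm. Qed.

Lemma cmod_meval_le_supnorm (R : realType) n (p : mpoly n R[i]) (z : 'I_n -> R[i]) :
  (forall i, cmod (z i) < 1) -> cmod (meval z p) <= supnorm p.
Proof.
move=> z1; apply: ub_le_sup; last by exists z.
pose d := msize p.
have pd : {in msupp p, forall m, (mdeg m <= d)%N}.
  by move=> m /msize_mdeg_lt/ltnW.
exists (\sum_(g : expo 'I_n d) cmod (mcoeff (multinom_of_expo g) p)) => _ [y y1 <-].
by rewrite (peval_meval _ pd); apply: cmod_peval_le_sum => i; exact/ltW/y1.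
Qed.

Lemma one_subX_le (R : realType) (t : R) k : 0 <= t <= 1 -> 1 - t ^+ k <= (1 - t) * k%:R.
Proof.
move=> /andP[t0 t1]; elim: k => [|k IH]; first by rewrite expr0 subrr mulr0.
have tk : 0 <= t ^+ k <= 1 by rewrite exprn_ge0// exprn_ile1.
by move: tk => /andP[tk0 tk1]; rewrite exprS -natr1; nra.
Qed.

(* The bound on the open polydisc passes to its closure along [t z], [t -> 1]. *)
Lemma cmod_meval_le_supnorm_closed (R : realType) n (p : mpoly n R[i]) (z : 'I_n -> R[i]) :
  (forall i, cmod (z i) <= 1) -> cmod (meval z p) <= supnorm p.
Proof.
move=> z1; pose d := msize p.
have pd : {in msupp p, forall m, (mdeg m <= d)%N}.
  by move=> m /msize_mdeg_lt/ltnW.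
pose c (g : expo 'I_n d) := mcoeff (multinom_of_expo g) p.
pose C : R := \sum_g cmod (c g) * (wt g)%:R.
have C0 : 0 <= C by apply: sumr_ge0 => g _; rewrite mulr_ge0 ?cmod_ge0.
have close (t : R) : 0 <= t < 1 -> cmod (meval z p) <= supnorm p + (1 - t) * C.
  move=> /andP[t0 t1].
  have -> : meval z p = meval (fun i => t%:C%C * z i) p +
      (meval z p - meval (fun i => t%:C%C * z i) p) by rewrite addrC subrK.
  apply: le_trans (le_normcD _ _) _; apply: lerD.
    apply: cmod_meval_le_supnorm => i; rewrite Normc.normcM cmod_real//.
    by apply: le_lt_trans t1; rewrite ler_piMr.
  rewrite !(peval_meval _ pd) /peval -sumrB; apply: le_trans (cmod_sum _ _) _.
  rewrite /C mulr_sumr; apply: ler_sum => g _.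
  rewrite mono_scale.
  have -> : c g * mono z g - c g * (t%:C%C ^+ wt g * mono z g) =
      c g * (mono z g * (1 - t ^+ wt g)%:C%C).
    rewrite rmorphB rmorphXn rmorph1 -mulrBr; congr (_ * _).
    by rewrite mulrBr mulr1 [mono z g * _]mulrC.
  have tw : 0 <= 1 - t ^+ wt g by rewrite subr_ge0 exprn_ile1// ltW.
  rewrite !Normc.normcM cmod_real// [(1 - t) * _]mulrCA ler_wpM2l ?cmod_ge0//.
  apply: le_trans (one_subX_le _ _); last by rewrite t0 ltW.
  by rewrite ler_piMl ?cmod_mono_le1.
apply/ler_addgt0Pr => e e0.
pose u := Num.min 1 (e / (C + 1)).
have u01 : 0 < u <= 1 by rewrite lt_min ltr01 divr_gt0 ?ltr_pwDr// ge_min lexx.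
have uC : u * C <= e.
  have C1 : 0 < C + 1 by rewrite ltr_pwDr.
  have : u <= e / (C + 1) by rewrite ge_min lexx orbT.
  rewrite ler_pdivlMr// => H; apply: le_trans H.
  by rewrite mulrDr mulr1 lerDl; case/andP: u01 => /ltW.
have := close (1 - u); rewrite subKr.
have -> : 0 <= 1 - u < 1 by move: u01 => /andP[? ?]; lra.
by move=> /(_ isT) H; apply: le_trans H _; rewrite lerD2l.
Qed.

Lemma coefnormE (R : realType) n d r (p : mpoly n R[i]) :
  (0 < r)%N -> {in msupp p, forall m, (mdeg m <= d)%N} ->
  coefnorm (bh_exp R r) p ^+ 2 =
  (\sum_(g : expo 'I_n d) cmod (mcoeff (multinom_of_expo g) p) `^ bh_exp R r)
     `^ (1 + r%:R^-1).
Proof.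
move=> r0 pd; rewrite /coefnorm -powR_mulrn ?powR_ge0// -powRrM.
have -> : (bh_exp R r)^-1 * 2%:R = 1 + r%:R^-1.
  by rewrite -(bh_expM R r0) mulKf// gt_eqF ?bh_exp_gt0.
rewrite (sum_msupp (d := d))// => m /memN_msupp_eq0 ->.
by rewrite Normc.normc0 powR0// gt_eqF ?bh_exp_gt0.
Qed.

Lemma supnorm_ge0 (R : realType) n (p : mpoly n R[i]) : 0 <= supnorm p.
Proof.
apply: le_trans (cmod_ge0 _) (@cmod_meval_le_supnorm R n p (fun=> 0) _) => i.
by rewrite Normc.normc0.
Qed.

Lemma bh_norm2Z (R : realType) (I : finType) d r (u : R[i]) (c : expo I d -> R[i]) :
  (0 < r)%N -> bh_norm2 r (fun g => u * c g) = cmod u ^+ 2 * bh_norm2 r c.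
Proof.
move=> r0; rewrite /bh_norm2.
under eq_bigr do rewrite Normc.normcM powRM ?cmod_ge0//.
rewrite -mulr_sumr powRM ?powR_ge0 ?sumr_ge0// => [|g _]; last exact: powR_ge0.
by rewrite -powRrM bh_expM// powR_mulrn ?cmod_ge0.
Qed.

(** [F] is divided by [supnorm F + e] with e > 0, which is positive even if the norm vanishes. The
    limit e -> 0 is taken on square roots, where the bound is affine in e. *)
Lemma sum_coefnorm_le (R : realType) (K : R) M n (F : mpoly n R[i]) (F_ : nat -> mpoly n R[i]) :
  0 < K -> bh_upto K M -> (forall r, (r <= M)%N -> F_ r \is homog r) -> F = \sum_(0 <= r < M.+1) F_ r ->
  \sum_(1 <= r < M.+1) coefnorm (bh_exp R r) (F_ r) ^+ 2 / r%:R ^+ 10 <=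
  (K * supnorm F) ^+ 2.
Proof.
move=> K0 SM homF FE.
have Fr r m : (r <= M)%N -> m \in msupp (F_ r) -> mdeg m = r.
  by move=> rM; have /dhomogP := homF r rM; exact.
have coefF m : (mdeg m <= M)%N -> mcoeff m F = mcoeff m (F_ (mdeg m)).
  move=> mM; rewrite FE raddf_sum big_mkord/= (bigD1 (Ordinal (mM : (mdeg m < M.+1)%N)))//=.
  rewrite big1 ?addr0// => r rm; apply: memN_msupp_eq0; apply: contra rm => mr.
  by apply/eqP/val_inj; rewrite /= (Fr r)// -ltnS.
have Fd : {in msupp F, forall m, (mdeg m <= M)%N}.
  move=> m; rewrite mcoeff_msupp; apply: contraNleq => mM.
  rewrite FE raddf_sum big_mkord/= big1// => r _; apply: memN_msupp_eq0.
  by apply: contraL mM => /Fr ->; rewrite -?leqNgt -ltnS.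
pose c (g : expo 'I_n M) := mcoeff (multinom_of_expo g) F.
have bound e : 0 < e -> \sum_(1 <= r < M.+1) coefnorm (bh_exp R r) (F_ r) ^+ 2 / r%:R ^+ 10 <=
    (K * (supnorm F + e)) ^+ 2.
  move=> e0; pose t := supnorm F + e.
  have t0 : 0 < t by rewrite ltr_wpDl ?supnorm_ge0.
  have ct : unitbd (fun g => (t^-1)%:C%C * c g).
    move=> z z1; have -> : peval (fun g => (t^-1)%:C%C * c g) z = (t^-1)%:C%C * meval z F.
      by rewrite (peval_meval z Fd) /peval mulr_sumr; apply: eq_bigr => g _; rewrite mulrA.
    rewrite Normc.normcM cmod_real ?invr_ge0 ?(ltW t0)// ler_pdivrMl// mulr1.
    by apply: le_trans (cmod_meval_le_supnorm_closed F z1) _; rewrite lerDl ltW.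
  have H := SM _ _ _ ct.
  rewrite exprMn -/t -ler_pdivrMr ?exprn_gt0// mulr_suml; apply: le_trans _ H.
  rewrite !big_nat; apply: ler_sum => r /andP[r0 rM].
  have rd : {in msupp (F_ r), forall m, (mdeg m <= M)%N} by move=> m /Fr ->.
  rewrite mulrAC (coefnormE r0 rd) (bh_norm2Z _ _ r0) cmod_real ?invr_ge0 ?(ltW t0)//.
  apply: ler_wpM2r; first by rewrite invr_ge0 exprn_ge0.
  rewrite exprVn mulrC; apply: ler_wpM2l; first by rewrite invr_ge0 exprn_ge0// ltW.
  rewrite le_eqVlt; apply/orP; left; apply/eqP; congr (_ `^ _).
  rewrite [RHS]big_mkcond/=; apply: eq_bigr => g _.
  case: eqP => gr; first by rewrite /c coefF mdeg_multinom_of_expo gr.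
  rewrite memN_msupp_eq0 ?Normc.normc0 ?powR0 ?gt_eqF ?bh_exp_gt0//.
  by apply/negP => /(Fr _ _ rM); rewrite mdeg_multinom_of_expo.
set S := \sum_(1 <= r < _) _ in bound *.
have S0 : 0 <= S by apply: sumr_ge0 => r _; rewrite divr_ge0 ?sqr_ge0 ?exprn_ge0.
have Sle e : 0 < e -> Num.sqrt S <= K * supnorm F + e.
  move=> e0; have e1 : 0 < e / K by rewrite divr_gt0.
  have -> : K * supnorm F + e = K * (supnorm F + e / K).
    by rewrite mulrDr mulrCA mulfV ?mulr1 ?gt_eqF.
  rewrite -[leRHS]ger0_norm ?mulr_ge0 ?addr_ge0 ?supnorm_ge0 ?(ltW e1) ?(ltW K0)// -sqrtr_sqr.
  by rewrite ler_wsqrtr// bound.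
have : Num.sqrt S <= K * supnorm F by apply/ler_addgt0Pr.
by move=> H; rewrite -(sqr_sqrtr S0) lerXn2r ?nnegrE ?sqrtr_ge0 ?mulr_ge0 ?supnorm_ge0 ?(ltW K0).
Qed.

Theorem theorem5p1 (R : realType) :
  exists B0 K : R,
    [/\ B0 = 5,
        forall (M n : nat) (F : mpoly n R[i]) (F_ : nat -> mpoly n R[i]),
          (1 <= M)%N ->
          (forall r : nat, (r <= M)%N -> F_ r \is homog r) ->
          F = \sum_(0 <= r < M.+1) F_ r ->
          Num.sqrt (\sum_(1 <= r < M.+1)
                      coefnorm (bh_exp R r) (F_ r) ^+ 2 / r%:R `^ (2 * B0))
            <= K * supnorm F
      & forall m : nat, (1 <= m)%N ->
          (bh_const R m <= (K * m%:R `^ B0)%:E)%E].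
Proof.
have [K K0 SK] : exists2 K : R, 0 < K & forall N, bh_upto K N.
  by exists 4000; [rewrite ltr0n | exact: bh_upto_4000].
exists 5, K; split => //.
  move=> M n F F_ _ homF FE.
  have pow10 r : r%:R `^ (2 * 5) = r%:R ^+ 10 :> R.
    by rewrite -natrM powR_mulrn.
  rewrite (eq_bigr (fun r => coefnorm (bh_exp R r) (F_ r) ^+ 2 / r%:R ^+ 10)); last first.
    by move=> r _; rewrite pow10.
  have H := sum_coefnorm_le K0 (SK M) homF FE.
  rewrite -[leRHS]ger0_norm ?mulr_ge0 ?supnorm_ge0 ?(ltW K0)// -sqrtr_sqr.
  exact: ler_wsqrtr.
move=> m m1; apply: ge_ereal_sup => _ [n _ <-].
apply: ge_ereal_sup => _ [P [homP _] <-]; rewrite lee_fin.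
have m0 : 0 < m%:R :> R by rewrite ltr0n.
rewrite powR_mulrn//.
pose F_ r : mpoly n R[i] := if r == m then P else 0.
have homF r : (r <= m)%N -> F_ r \is homog r.
  by rewrite /F_; case: eqP => [->|_] // _; exact: dhomog0.
have PE : P = \sum_(0 <= r < m.+1) F_ r.
  rewrite big_nat_recr//= /F_ eqxx big_nat big1 ?add0r// => r /andP[_ rm].
  by rewrite ltn_eqF.
have H := sum_coefnorm_le K0 (SK m) homF PE.
have : coefnorm (bh_exp R m) P ^+ 2 / m%:R ^+ 10 <= (K * supnorm P) ^+ 2.
  apply: le_trans H; rewrite big_nat_recr//= /F_ eqxx lerDr sumr_ge0// => r _.
  by rewrite divr_ge0 ?sqr_ge0 ?exprn_ge0.
rewrite ler_pdivrMr ?exprn_gt0//.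
have -> : (K * supnorm P) ^+ 2 * m%:R ^+ 10 = (K * m%:R ^+ 5 * supnorm P) ^+ 2.
  by rewrite -[10%N]/(5 * 2)%N exprM -exprMn mulrAC.
have KS : 0 <= K * m%:R ^+ 5 * supnorm P.
  by apply: mulr_ge0 (supnorm_ge0 P); apply: mulr_ge0; [exact: ltW | exact: exprn_ge0].
rewrite ler_sqr ?nnegrE ?powR_ge0// => H2.
(* If the norm vanishes, the quotient is 0 by the convention for division by zero. *)
have [S0|S0] := eqVneq (supnorm P) 0.
  by rewrite S0 invr0 mulr0 mulr_ge0 ?exprn_ge0// ltW.
by rewrite ler_pdivrMr// lt_def S0 supnorm_ge0.
Qed.
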